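(* Let $\lambda$ be a positive integer, $n\ge0$ an integer, and for integers $m\ge0$ let \[ I_{m,n}^{(\lambda)}=\int_0^\pi \cos(2m\theta)\,\log\big(C_n^{(\lambda)}(\cos\theta)\big)^2\,\mathrm{d}\theta . \] Then \[ I_{0,n}^{(\lambda)}=2\pi\log\left(\frac{(\lambda)_n}{n!}\right), \] and for $m\ge1$, \[ I_{m,n}^{(\lambda)}=\frac{(2\lambda-1)\pi}{m}+\frac{\pi}{(2m)!}\,\frac{d^{2m}}{dz^{2m}}\left.\left(\log\sum_{\nu=0}^{\lambda-1}\alpha_{\nu,n}^{(\lambda)}\big(z^{2n+2\lambda+2\nu}-z^{2\lambda-2\nu-2}\big)\right)\right|_{z=0}. \]
   Context: $C_n^{(\lambda)}(x)$ denotes the Gegenbauer polynomial of degree $n$ and parameter $\lambda$, defined by $(1-2xt+t^2)^{-\lambda}=\sum_{n\ge0}C_n^{(\lambda)}(x)t^n$. $(a)_k=\Gamma(a+k)/\Gamma(a)$ is the Pochhammer symbol, and $\alpha_{\nu,n}^{(\lambda)}=\dfrac{(1-\lambda)_\nu (n+1)_\nu}{\nu!\,(n+\lambda+1)_\nu}$. The polynomial $p(z)=\sum_{\nu=0}^{\lambda-1}\alpha_{\nu,n}^{(\lambda)}(z^{2n+2\lambda+2\nu}-z^{2\lambda-2\nu-2})$ satisfies $p(0)=-\alpha_{\lambda-1,n}^{(\lambda)}\neq0$, so $\log p(z)$ is holomorphic near $z=0$ for any choice of branch and its derivatives of order $\ge1$ at $0$ do not depend on the branch. *)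

(* Defs.v *)
From HB Require Import structures.
From mathcomp Require Import all_boot all_order all_algebra.
From mathcomp Require Import all_classical all_reals all_analysis.
Set Implicit Arguments. Unset Strict Implicit. Unset Printing Implicit Defensive.
Import Order.TTheory GRing.Theory Num.Theory.
Import numFieldNormedType.Exports.
Local Open Scope ring_scope.

Definition pochhammer {R : pzRingType} (a : R) (k : nat) : R :=
  \prod_(i < k) (a + i%:R).

(* Gegenbauer polynomial via its generating function:
   C_n^(lam)(x) is the n-th Taylor coefficient at t = 0 of
   t |-> (1 - 2 x t + t^2)^(-lam) (lam a positive integer here). *)
Definition gegenbauer {R : realType} (lam n : nat) (x : R) : R :=
  derive1n n (fun t : R => (1 - 2 * x * t + t ^+ 2) ^- lam) 0 / n`!%:R.

Definition alpha {R : realType} (lam nu n : nat) : R :=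
  pochhammer (1 - lam%:R) nu * pochhammer (n.+1)%:R nu
  / (nu`!%:R * pochhammer (n + lam).+1%:R nu).

Definition pz {R : realType} (lam n : nat) (z : R) : R :=
  \sum_(nu < lam) alpha lam nu n *
     (z ^+ (2 * n + 2 * lam + 2 * nu) - z ^+ (2 * lam - 2 * nu - 2)).

Definition Iintegrand {R : realType} (lam n m : nat) (t : R) : R :=
  cos ((2 * m)%:R * t) * ln ((gegenbauer lam n (cos t)) ^+ 2).

Definition Iset {R : realType} : set R := `[0, pi]%classic.

Definition Imn {R : realType} (lam n m : nat) : \bar R :=
  (\int[@lebesgue_measure R]_(t in Iset) (Iintegrand lam n m t)%:E)%E.

(* Main.v *)
(* Write [C_n^(lam)(x) = 2^n (lam)_n / n! * prod_k (x - cos phi_k)]: all zeros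
   are real and lie in ]-1, 1[, by Rolle's theorem starting from [lam = 1]
   (zeros [cos (k pi / (n + 1))]), since [C_(n+1)^(lam)' = 2 lam C_n^(lam+1)].

   On the integral side, [ln |2 (cos t - cos phi)|] is
   [g (t + phi) + g (t - phi)] with [g u = ln |2 sin (u / 2)|]; translating over
   a full period reduces everything to the Fourier coefficients
   [int_0^pi cos (j u) g u du], which are [0] for [j = 0] (duplication formula)
   and [- pi / (2 j)] for [j > 0] (integration by parts and the Dirichlet
   kernel).  Hence [I_m = - pi / m * sum_k cos (2 m phi_k)] for [m > 0].

   On the Taylor side, the finite sine expansion of
   [sin^(2 lam - 1) t * C_n^(lam) (cos t)] says that [p z] is a nonzero constant
   times [(z^2 - 1)^(2 lam - 1) prod_k (1 - 2 z cos phi_k + z^2)], and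
   [ln (1 - 2 z cos phi + z^2)] has Taylor coefficients [- 2 cos (j phi) / j]. *)

Require Import Defs.
From HB Require Import structures.
From mathcomp Require Import all_boot all_order all_algebra.
From mathcomp Require Import all_classical all_reals all_analysis.
From mathcomp Require Import measurable_realfun ring lra zify.
Set Implicit Arguments.
Unset Strict Implicit.
Unset Printing Implicit Defensive.
Import Order.TTheory GRing.Theory Num.Theory.
Import numFieldNormedType.Exports.
Local Open Scope ring_scope.

(** * Taylor coefficients at 0 *)

(** The real function [ln |p|] stands for [log p]: near 0 on the real line [p] keeps a constant
    sign, so any branch differs from it by a constant and the derivatives of order at least 1 agree.

    The identity for [p] is an induction on [lam] with [n] free. Multiplication by
    [1 - x^2 = sin^2 t] turns [C_n^(lam+1)] into a combination of [C_n^(lam)] and [C_(n+2)^(lam)],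
    and [p] obeys a recurrence of the same shape, so only constants have to be matched.

    The zeros 1 and -1 of [p] are treated like the others, as the angles 0 and [pi] in
    [1 - 2 z cos phi + z^2]. Their share of the coefficient of order [2 m] is what the term
    [(2 lam - 1) pi / m] cancels, leaving the sum over [phi_k] found on the integral side.

    Two analytic obstacles shape the rest. Rules for iterated derivatives need differentiability on
    neighbourhoods, hence a class of functions stable under derivation. The logarithmic
    singularities need an explicit integrable majorant and a fundamental theorem that tolerates a
    singular endpoint. *)

Section TaylorCoefficients.
Context {R : realType}.
Implicit Types f g : R -> R.

(** Linearity and product rules for iterated derivatives need differentiability around 0, not only
    at 0. Germs of fractions provide it at every order, being stable under [derive1], and they
    contain the generating functions. *)
Definition rational_near0 f : Prop :=
  exists P Q : {poly R}, Q.[0] != 0 /\ \forall t \near 0, f t = P.[t] / Q.[t].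

Lemma horner_near_neq0 (Q : {poly R}) :
  Q.[0] != 0 -> \forall t \near 0, Q.[t] != 0.
Proof.
by move=> Q0; have /cvgr_neq0 := @continuous_horner R Q 0; apply.
Qed.

Lemma is_derive_frac (P Q : {poly R}) t : Q.[t] != 0 ->
  is_derive t 1 (fun s => P.[s] / Q.[s])
    ((P^`() * Q - P * Q^`()).[t] / (Q ^+ 2).[t]).
Proof.
move=> Qt.
have -> : (fun s => P.[s] / Q.[s]) = (horner P) * (fun s => (Q.[s])^-1).
  by [].
have dV := is_deriveV Qt (is_derive_poly Q t).
apply: is_derive_eq; rewrite !hornerE /= /GRing.scale /=.
by field.
Qed.

Lemma rational_near0_is_derive f : rational_near0 f ->
  exists P Q : {poly R}, Q.[0] != 0 /\
    \forall t \near 0, is_derive (t : R) 1 f (P.[t] / Q.[t]).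
Proof.
move=> [P [Q [Q0 fPQ]]].
exists (P^`() * Q - P * Q^`()), (Q ^+ 2); split.
  by rewrite hornerE expf_neq0.
(* A derivative at [t] sees [f] around [t]: [near_join] turns agreement near 0 into agreement near
   each [t] close to 0. *)
have Qn := horner_near_neq0 Q0; move/near_join: fPQ => fPQ.
near=> t; have Qt : Q.[t] != 0 by near: t.
apply: (@near_eq_is_derive _ _ _ (fun s => P.[s] / Q.[s])).
  have h : \forall s \near t, f s = P.[s] / Q.[s] by near: t.
  by apply: filterS h => s ->.
exact: is_derive_frac.
Unshelve. all: by end_near. Qed.

Lemma rational_near0_derivable f : rational_near0 f ->
  \forall t \near 0, derivable f (t : R) 1.
Proof.
by move=> /rational_near0_is_derive [P [Q [_ h]]]; apply: filterS h => t [].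
Qed.

Lemma rational_near0_derive1 f : rational_near0 f -> rational_near0 (derive1 f).
Proof.
move=> /rational_near0_is_derive [P [Q [Q0 h]]]; exists P, Q; split => //.
by apply: filterS h => t h; rewrite derive1E derive_val.
Qed.

Lemma rational_near0_horner (P : {poly R}) : rational_near0 (horner P).
Proof.
exists P, 1; rewrite hornerE oner_neq0; split => //.
by near=> t; rewrite hornerE divr1.
Unshelve. all: by end_near. Qed.

Lemma rational_near0_cst (c : R) : rational_near0 (fun=> c).
Proof.
rewrite (_ : (fun=> c) = horner c%:P); first exact: rational_near0_horner.
by apply/funext => t; rewrite hornerC.
Qed.

Lemma rational_near0_id : rational_near0 (@id R).
Proof.
rewrite (_ : id = horner 'X); first exact: rational_near0_horner.
by apply/funext => t; rewrite hornerX.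
Qed.

Lemma rational_near0D f g : rational_near0 f -> rational_near0 g ->
  rational_near0 (fun t => f t + g t).
Proof.
move=> [P [Q [Q0 h]]] [P' [Q' [Q'0 h']]].
exists (P * Q' + P' * Q), (Q * Q'); split; first by rewrite hornerE mulf_neq0.
have Qn := horner_near_neq0 Q0; have Q'n := horner_near_neq0 Q'0.
near=> t.
have e : f t = P.[t] / Q.[t] by near: t.
have e' : g t = P'.[t] / Q'.[t] by near: t.
have q : Q.[t] != 0 by near: t.
have q' : Q'.[t] != 0 by near: t.
by rewrite e e' !hornerE; field; rewrite q q'.
Unshelve. all: by end_near. Qed.

Lemma rational_near0M f g : rational_near0 f -> rational_near0 g ->
  rational_near0 (fun t => f t * g t).
Proof.
move=> [P [Q [Q0 h]]] [P' [Q' [Q'0 h']]].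
exists (P * P'), (Q * Q'); split; first by rewrite hornerE mulf_neq0.
near=> t.
have e : f t = P.[t] / Q.[t] by near: t.
have e' : g t = P'.[t] / Q'.[t] by near: t.
by rewrite e e' !hornerM mulf_div.
Unshelve. all: by end_near. Qed.

Definition taylor_coef (n : nat) f : R := derive1n n f 0 / n`!%:R.

Lemma near_eq_derive1n n f g : (\forall t \near 0, f t = g t) ->
  \forall t \near 0, derive1n n f t = derive1n n g t.
Proof.
elim: n => [//|n IH] /IH /near_join.
by apply: filterS => t h; rewrite !derive1nS !derive1E; exact: near_eq_derive.
Qed.

Lemma taylor_coef_near_eq n f g : (\forall t \near 0, f t = g t) ->
  taylor_coef n f = taylor_coef n g.
Proof.
by move=> /(near_eq_derive1n n) /nbhs_singleton h; rewrite /taylor_coef h.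
Qed.

Lemma taylor_coef0 f : taylor_coef 0 f = f 0.
Proof. by rewrite /taylor_coef derive1n0 fact0 divr1. Qed.

Lemma taylor_coef_derive1 n f :
  taylor_coef n (derive1 f) = n.+1%:R * taylor_coef n.+1 f.
Proof.
rewrite /taylor_coef derive1Sn factS natrM.
have n0 : n`!%:R != 0 :> R by rewrite pnatr_eq0 -lt0n fact_gt0.
have m0 : n.+1%:R != 0 :> R by rewrite pnatr_eq0.
by move: n.+1%:R m0 => m m0; field; rewrite m0 n0.
Qed.

Lemma taylor_coefS n f : taylor_coef n.+1 f = taylor_coef n (derive1 f) / n.+1%:R.
Proof. by rewrite taylor_coef_derive1 mulrC mulKf// pnatr_eq0. Qed.

Lemma taylor_coefD n f g : rational_near0 f -> rational_near0 g ->
  taylor_coef n (fun t => f t + g t) = taylor_coef n f + taylor_coef n g.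
Proof.
elim: n f g => [|n IH] f g rf rg; first by rewrite !taylor_coef0.
rewrite !taylor_coefS -mulrDl -IH; [|exact: rational_near0_derive1..].
congr (_ / _); apply: taylor_coef_near_eq.
have df := rational_near0_derivable rf; have dg := rational_near0_derivable rg.
apply: filterS2 df dg => t dft dgt; rewrite !derive1E.
by rewrite (_ : (fun t => f t + g t) = f + g)// deriveD.
Qed.

Lemma taylor_coefZ n c f : rational_near0 f ->
  taylor_coef n (fun t => c * f t) = c * taylor_coef n f.
Proof.
elim: n f => [|n IH] f rf; first by rewrite !taylor_coef0.
rewrite !taylor_coefS mulrA -IH; last exact: rational_near0_derive1.
congr (_ / _); apply: taylor_coef_near_eq.
have df := rational_near0_derivable rf.
apply: filterS df => t dft; rewrite !derive1E.
by rewrite (_ : (fun t => c * f t) = c *: f)// deriveZ.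
Qed.

(** Multiplication of a generating function by [t]. The value 0 at index 0 encodes [C_(-1) = 0], so
    the recurrences hold from [n = 0] on. *)
Definition shift_seq (a : nat -> R) (n : nat) : R :=
  if n is n'.+1 then a n' else 0.

(** Induction from [(t f)' = f + t f']: at order [n] the right side has coefficient [a_n + n a_n],
    and the factor [n + 1] cancels. *)
Lemma taylor_coef_mulX n f : rational_near0 f ->
  taylor_coef n (fun t => t * f t) = shift_seq (taylor_coef^~ f) n.
Proof.
elim: n f => [|n IH] f rf; first by rewrite taylor_coef0 mul0r.
have rf' := rational_near0_derive1 rf.
have rX := rational_near0_id.
rewrite taylor_coefS /=.
have -> : taylor_coef n (derive1 (fun t => t * f t)) =
          taylor_coef n (fun t => f t + t * (derive1 f) t).
  apply: taylor_coef_near_eq; have df := rational_near0_derivable rf.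
  near=> t; rewrite !derive1E.
  have dft : derivable f t 1 by near: t.
  have -> : (fun t => t * f t) = id * f by [].
  rewrite (deriveM (@derivable_id _ _ t 1) dft) derive_id addrC.
  by rewrite [in LHS]/GRing.scale /= mulr1.
rewrite taylor_coefD //; last exact: rational_near0M.
rewrite IH //; case: n {IH} => [|n] /=; first by rewrite addr0 divr1.
rewrite taylor_coef_derive1; set a := taylor_coef _ _.
have -> : a + n.+1%:R * a = n.+2%:R * a by rewrite -[n.+2%:R]natr1; ring.
by rewrite mulrAC divff ?mul1r// pnatr_eq0.
Unshelve. all: by end_near. Qed.

End TaylorCoefficients.

(** * Recurrences in the parameter and the degree *)

Section GegenbauerRecurrences.
Context {R : realType}.

Let qpoly (x : R) : {poly R} := 1 - (2 * x) *: 'X + 'X ^+ 2.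

Let qpolyE x t : (qpoly x).[t] = 1 - 2 * x * t + t ^+ 2.
Proof. by rewrite /qpoly !hornerE. Qed.

Let fE lam (x : R) : (fun t : R => (1 - 2 * x * t + t ^+ 2) ^- lam) =
  (fun t => (1 : {poly R}).[t] / (qpoly x ^+ lam).[t]).
Proof. by apply/funext => t; rewrite horner_exp qpolyE hornerE mul1r. Qed.

Let q_neq0 (x : R) : \forall t \near 0, 1 - 2 * x * t + t ^+ 2 != 0.
Proof.
have : (qpoly x).[0] != 0 by rewrite qpolyE mulr0 expr0n subr0 addr0 oner_eq0.
by move/horner_near_neq0; apply: filterS => t; rewrite qpolyE.
Qed.

Lemma rational_near0_quadraticV lam (x : R) :
  rational_near0 (fun t => (1 - 2 * x * t + t ^+ 2) ^- lam).
Proof.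
exists 1, (qpoly x ^+ lam); split.
  by rewrite horner_exp qpolyE mulr0 expr0n subr0 addr0 expr1n oner_eq0.
by near=> t; have := congr1 (@^~ t) (fE lam x).
Unshelve. all: by end_near. Qed.

(** With [q = 1 - 2 x t + t^2], this is [q^(-lam) = q q^(-lam-1)] read on coefficients. *)
Lemma gegenbauer_rec lam n (x : R) :
  gegenbauer lam n x = gegenbauer lam.+1 n x
    - 2 * x * shift_seq (gegenbauer lam.+1 ^~ x) n
    + shift_seq (shift_seq (gegenbauer lam.+1 ^~ x)) n.
Proof.
have rf := rational_near0_quadraticV lam.+1 x.
set f := (fun t : R => _) in rf.
have rX := rational_near0_id.
have rXf : rational_near0 (fun t => t * f t) by exact: rational_near0M.
have rXXf : rational_near0 (fun t => t * (t * f t)) by exact: rational_near0M.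
have rZ : rational_near0 (fun t => (- (2 * x)) * (t * f t)).
  by apply: rational_near0M => //; exact: rational_near0_cst.
rewrite -[LHS]/(taylor_coef n _).
rewrite (@taylor_coef_near_eq _ _ _
  (fun t => (f t + (- (2 * x)) * (t * f t)) + t * (t * f t))); last first.
  apply: filterS (q_neq0 x) => t qt; rewrite /f [_ ^+ lam.+1]exprS.
  move: qt; set q := (X in X != 0) => qt.
  have -> : forall y, y + - (2 * x) * (t * y) + t * (t * y) = q * y.
    by move=> y; rewrite /q; ring.
  by rewrite invfM mulrA divff ?mul1r.
rewrite taylor_coefD //; last exact: rational_near0D.
rewrite taylor_coefD // taylor_coefZ // !taylor_coef_mulX // mulNr.
congr (_ - _ * _ + _); case: n => [//|n] /=.
by rewrite taylor_coef_mulX.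
Qed.

(** Coefficients of [(q^(-lam))' = 2 lam (x - t) q^(-lam-1)], the derivative being in [t]. *)
Lemma gegenbauer_derive_gen lam n (x : R) :
  n.+1%:R * gegenbauer lam n.+1 x =
  2 * lam%:R * (x * gegenbauer lam.+1 n x
                - shift_seq (gegenbauer lam.+1 ^~ x) n).
Proof.
have rf := rational_near0_quadraticV lam.+1 x.
set f := (fun t : R => _) in rf.
have rXf : rational_near0 (fun t => t * f t).
  by apply: rational_near0M => //; exact: rational_near0_id.
rewrite -[gegenbauer lam _ _]/(taylor_coef n.+1 _) -taylor_coef_derive1.
rewrite (@taylor_coef_near_eq _ _ _
  (fun t => (2 * lam%:R * x) * f t + (- (2 * lam%:R)) * (t * f t))); last first.
  apply: filterS (q_neq0 x) => t qt.
  rewrite derive1E fE.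
  have Qt : (qpoly x ^+ lam).[t] != 0 by rewrite horner_exp qpolyE expf_neq0.
  have dF := is_derive_frac 1 Qt; rewrite derive_val {dF}.
  rewrite derivC mul0r sub0r mul1r deriv_exp !(hornerN, hornerMn, hornerM).
  rewrite !horner_exp qpolyE /f.
  have -> : (qpoly x)^`().[t] = 2 * (t - x).
    rewrite /qpoly expr2 !(derivD, derivN, derivZ, derivM, derivX, derivC).
    by rewrite !(hornerD, hornerN, hornerZ, hornerM, hornerX, hornerC); ring.
  case: lam {f rf rXf Qt} => [|l] /=.
    by rewrite mulr0n !mulr0 !(mul0r, oppr0, addr0).
  rewrite -mulr_natr !exprS expr0 mulr1.
  by field; rewrite -expr2 expf_neq0 qt.
rewrite taylor_coefD; [|apply: rational_near0M => //; exact: rational_near0_cst..].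
rewrite !taylor_coefZ // taylor_coef_mulX //.
by rewrite /gegenbauer -/f -/(taylor_coef n f); lra.
Qed.

Lemma gegenbauer_lam0 n (x : R) : gegenbauer 0 n x = (n == 0)%:R.
Proof.
have -> : gegenbauer 0 n x = taylor_coef n (fun=> 1).
  congr (taylor_coef n _); apply/funext => t; by rewrite expr0 invr1.
elim: n => [|n IH]; first by rewrite taylor_coef0.
have rc : rational_near0 (fun _ : R => 1 : R) by exact: rational_near0_cst.
rewrite taylor_coefS.
have -> : derive1 (fun _ : R => 1 : R) = (fun t => 0 * (fun=> 1) t).
  by apply/funext => t; rewrite mul0r derive1_cst.
by rewrite taylor_coefZ // !mul0r.
Qed.

Section SequenceRecurrences.
Variables (c d : nat -> R) (lam x : R).
Hypothesis rec_cd : forall n,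
  c n = d n - 2 * x * shift_seq d n + shift_seq (shift_seq d) n.
Hypothesis deriv_cd : forall n,
  n.+1%:R * c n.+1 = 2 * lam * (x * d n - shift_seq d n).

(** Coefficients of [q f' = 2 lam (x - t) f] for [f = q^(-lam)]. Abstract sequences let
    [gegenbauer_raise] use this section at two consecutive parameters. *)
Lemma three_term_of_rec n : n.+1%:R * c n.+1 =
  2 * (n%:R + lam) * x * c n - (n%:R - 1 + 2 * lam) * shift_seq c n.
Proof.
case: n => [|[|n]].
- by rewrite deriv_cd [c 0%N]rec_cd /=; ring.
- have h := deriv_cd 0%N; rewrite deriv_cd /=; rewrite /= in h.
  transitivity (2 * x * (1%:R * c 1%N) + 2 * lam * (x * c 1%N - c 0%N)).
    by rewrite h [c 1%N]rec_cd [c 0%N]rec_cd /=; ring.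
  by ring.
- have h := deriv_cd n.+1; have h' := deriv_cd n; rewrite deriv_cd /=.
  rewrite /= in h h'.
  transitivity (2 * x * (n.+2%:R * c n.+2) - n.+1%:R * c n.+1
     + 2 * lam * (x * c n.+2 - c n.+1)).
    by rewrite h h' [c n.+2]rec_cd [c n.+1]rec_cd /=; ring.
  by rewrite -[n.+2%:R]natr1; ring.
Qed.

(** The relations for [(n + 2 lam) c_n] and [(n + 2) c_(n+2)] involve [d] at [n - 1], [n] and
    [n + 1]; the three-term recurrence of [d], taken as hypothesis, eliminates the outer two. *)
Lemma raise_of_rec n :
  n.+1%:R * d n.+1 =
    2 * (n%:R + (lam + 1)) * x * d n
    - (n%:R - 1 + 2 * (lam + 1)) * shift_seq d n ->
  4 * lam * (n%:R + lam + 1) * (1 - x ^+ 2) * d n =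
  (n%:R + 2 * lam) * (n%:R + 2 * lam + 1) * c n
  - (n%:R + 1) * (n%:R + 2) * c n.+2.
Proof.
move=> T; have h := deriv_cd n.+1; rewrite /= in h.
have N : (n%:R + 2 * lam) * c n = 2 * lam * (d n - x * shift_seq d n).
  rewrite mulrDl [X in _ * _ + _ * X]rec_cd.
  case: n {T h} => [|n]; first by rewrite /=; ring.
  by rewrite deriv_cd /=; ring.
transitivity ((n%:R + 2 * lam + 1) * ((n%:R + 2 * lam) * c n)
   - (n%:R + 1) * (n.+2%:R * c n.+2)); last first.
  by rewrite -[n.+2%:R]natr1 -[n.+1%:R]natr1; ring.
rewrite N h.
transitivity ((n%:R + 2 * lam + 1) * (2 * lam * (d n - x * shift_seq d n))
   - 2 * lam * (x * (n.+1%:R * d n.+1) - (n%:R + 1) * d n)); last first.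
  by rewrite -[n.+1%:R]natr1; ring.
by rewrite T; ring.
Qed.

End SequenceRecurrences.

(** At [x = cos t] the factor [1 - x^2] supplies the two extra powers of the sine that the finite
    sine expansion gains when [lam] grows by one; this drives the induction on [lam]. *)
Lemma gegenbauer_raise lam n (x : R) :
  4 * lam%:R * (n%:R + lam%:R + 1) * (1 - x ^+ 2) * gegenbauer lam.+1 n x =
  (n%:R + 2 * lam%:R) * (n%:R + 2 * lam%:R + 1) * gegenbauer lam n x
  - (n%:R + 1) * (n%:R + 2) * gegenbauer lam n.+2 x.
Proof.
apply: (@raise_of_rec (gegenbauer lam ^~ x) (gegenbauer lam.+1 ^~ x)).
- by move=> k; exact: gegenbauer_rec.
- by move=> k; exact: gegenbauer_derive_gen.
rewrite natr1; apply: (@three_term_of_rec _ (gegenbauer lam.+2 ^~ x)).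
- by move=> k; exact: gegenbauer_rec.
- by move=> k; exact: gegenbauer_derive_gen.
Qed.

End GegenbauerRecurrences.

(** * The polynomial p and the finite sine expansion *)

Section SineExpansion.
Context {R : realType}.

Lemma pochhammer0 (a : R) : pochhammer a 0 = 1.
Proof. by rewrite /pochhammer big_ord0. Qed.

Lemma pochhammerS (a : R) k : pochhammer a k.+1 = pochhammer a k * (a + k%:R).
Proof. by rewrite /pochhammer big_ord_recr. Qed.

Lemma pochhammerSl (a : R) k : pochhammer a k.+1 = a * pochhammer (a + 1) k.
Proof.
rewrite /pochhammer big_ord_recl addr0; congr (_ * _).
by apply: eq_bigr => i _; rewrite -addrA (addrC 1) natr1.
Qed.

Lemma pochhammer_nat_neq0 n k : pochhammer (n.+1%:R : R) k != 0.
Proof.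
rewrite /pochhammer; apply/prodf_neq0 => i _.
by rewrite -natrD pnatr_eq0 addSn.
Qed.

Lemma alpha0 lam n : alpha lam 0 n = 1 :> R.
Proof. by rewrite /alpha !pochhammer0 fact0 !mulr1 divr1. Qed.

(** [(1 - lam)_nu] vanishes at [nu = lam], so the sum defining [p] may run one index further. *)
Lemma alpha_diag lam n : alpha lam.+1 lam.+1 n = 0 :> R.
Proof.
rewrite /alpha pochhammerS (_ : 1 - lam.+1%:R + lam%:R = 0).
  by rewrite !(mulr0, mul0r).
by rewrite -natr1; ring.
Qed.

(** The coefficient comparison behind [pz_rec]. Everything is rewritten through [(1 - lam)_nu],
    [(n + 3)_nu] and [(n + lam + 3)_nu], after which a rational identity remains. *)
Lemma alpha_rec lam nu n :
  alpha lam.+1 nu.+1 n = alpha lam nu.+1 n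
    - (n%:R + 1) * (n%:R + 2) / ((n%:R + lam%:R + 1) * (n%:R + lam%:R + 2))
      * alpha lam nu n.+2 :> R.
Proof.
rewrite /alpha.
have n1 : n%:R + 1 != 0 :> R by rewrite natr1 pnatr_eq0.
have nnu : n%:R + 1 + (nu%:R + 1) != 0 :> R by rewrite !natr1 -natrD pnatr_eq0.
have l1 : n%:R + lam%:R + 1 != 0 :> R by rewrite -natrD natr1 pnatr_eq0.
have l2 : n%:R + lam%:R + 1 + 1 != 0 :> R by rewrite -natrD !natr1 pnatr_eq0.
have lnu : n%:R + lam%:R + 1 + (nu%:R + 1) != 0 :> R.
  by rewrite -natrD !natr1 -natrD pnatr_eq0.
have nu1 : nu%:R + 1 != 0 :> R by rewrite natr1 pnatr_eq0.
have D0 := pochhammer_nat_neq0 (n.+2 + lam) nu.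
have f0 : nu`!%:R != 0 :> R by rewrite pnatr_eq0 -lt0n fact_gt0.
have up : pochhammer (n.+1%:R : R) nu.+1 =
   (n%:R + 1) * (n%:R + 1 + 1) * pochhammer (n.+3%:R : R) nu
     / (n%:R + 1 + (nu%:R + 1)).
  apply: (mulIf nnu); rewrite divfK // -mulrA -[n.+3%:R]natr1 -[n.+2%:R]natr1.
  rewrite -[n.+1%:R]natr1 -pochhammerSl -pochhammerSl [RHS]pochhammerS.
  by rewrite -natr1.
have dn : pochhammer ((n + lam).+1%:R : R) nu.+1 =
   (n%:R + lam%:R + 1) * (n%:R + lam%:R + 1 + 1)
     * pochhammer ((n.+2 + lam).+1%:R : R) nu
     / (n%:R + lam%:R + 1 + (nu%:R + 1)).
  apply: (mulIf lnu); rewrite divfK // -mulrA !addSn -[(n + lam).+3%:R]natr1.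
  rewrite -[(n + lam).+2%:R]natr1 -[(n + lam).+1%:R]natr1 natrD.
  rewrite -pochhammerSl -pochhammerSl [RHS]pochhammerS.
  by rewrite -natr1.
have dn' : pochhammer ((n + lam.+1).+1%:R : R) nu.+1 =
   (n%:R + lam%:R + 1 + 1) * pochhammer ((n.+2 + lam).+1%:R : R) nu.
  rewrite pochhammerSl addnS !addSn -[(n + lam).+3%:R]natr1.
  by rewrite -[(n + lam).+2%:R]natr1 -[(n + lam).+1%:R]natr1 natrD.
have pl : pochhammer (1 - lam.+1%:R : R) nu.+1 =
   (- lam%:R) * pochhammer (1 - lam%:R) nu.
  by rewrite pochhammerSl -natr1; congr (_ * pochhammer _ _); ring.
rewrite up dn dn' pl [pochhammer (1 - _) nu.+1]pochhammerS.
rewrite factS natrM -[nu.+1%:R]natr1.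
move: (pochhammer (n.+2 + lam).+1%:R nu) D0 => D D0.
move: (pochhammer n.+3%:R nu) (pochhammer (1 - lam%:R) nu) => B A.
move: nu`!%:R f0 => f f0.
move: (n%:R : R) (lam%:R : R) (nu%:R : R) n1 nnu l1 l2 lnu nu1.
move=> N L M n1 nnu l1 l2 lnu nu1; field.
have -> : N + L + 2 = N + L + 1 + 1 by ring.
by rewrite D0 f0 l2 l1 lnu nu1 nnu.
Qed.

(** Counterpart for [p] of [gegenbauer_raise]. Multiplication by [z^2] gives the powers of parameter
    [lam.+2] at the same [nu]; passing from [n] to [n + 2] gives those at [nu.+1]. *)
Lemma pz_rec lam n (z : R) :
  pz lam.+2 n z = z ^+ 2 * pz lam.+1 n z
    - (n%:R + 1) * (n%:R + 2) / ((n%:R + lam.+1%:R + 1) * (n%:R + lam.+1%:R + 2))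
      * pz lam.+1 n.+2 z.
Proof.
set k := _ / _; rewrite /pz.
pose e nu := z ^+ (2 * n + 2 * lam.+2 + 2 * nu) - z ^+ (2 * lam.+2 - 2 * nu - 2).
transitivity (\sum_(nu < lam.+2) alpha lam.+1 nu n * e nu
  - k * \sum_(nu < lam.+1) alpha lam.+1 nu n.+2 * e nu.+1).
  rewrite big_ord_recl [in RHS]big_ord_recl !alpha0 -addrA; congr (_ + _).
  rewrite mulr_sumr -sumrB; apply: eq_bigr => i _.
  by rewrite lift0 alpha_rec -/k mulrBl -[k * _ * _]mulrA.
congr (_ - k * _).
  rewrite big_ord_recr /= alpha_diag mul0r addr0 mulr_sumr.
  apply: eq_bigr => i _; rewrite [RHS]mulrCA /e [in RHS]mulrBr -!(exprD z 2).
  by congr (_ * (z ^+ _ - z ^+ _)); have := ltn_ord i; lia.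
by apply: eq_bigr => i _; congr (_ * (z ^+ _ - z ^+ _)); lia.
Qed.

(** Ratio of the two sides of the sine expansion at parameter [lam.+1]. Each step divides the
    coefficient of [C_n^(lam)] in [gegenbauer_raise] by that of [C_n^(lam+1)]; the sign and the loss
    of the factor 4 come from [sin^2 t = - (z - 1/z)^2 / 4]. *)
Fixpoint sine_factor (lam n : nat) : R :=
  if lam is l.+1 then
    - ((n%:R + 2 * lam%:R) * (n%:R + 2 * lam%:R + 1)
       / (lam%:R * (n%:R + lam%:R + 1))) * sine_factor l n
  else 1.

Lemma sine_factor_neq0 lam n : sine_factor lam n != 0.
Proof.
elim: lam => [|l IH] /=; first exact: oner_neq0.
rewrite mulf_neq0 // oppr_eq0 -natrM -!natrD !natr1 !mulf_neq0 ?invr_eq0 //.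
all: by rewrite ?mulf_neq0 ?pnatr_eq0 // -lt0n; lia.
Qed.

(** Relates the constants of degrees [n + 2] and [n]; their quotient turns the coefficient of
    [C_(n+2)^(lam)] in [gegenbauer_raise] into the one of [pz_rec]. *)
Lemma sine_factor_shift lam n :
  sine_factor lam n.+2 * ((n%:R + lam%:R + 2) * (n%:R + lam%:R + 3)) =
  sine_factor lam n * ((n%:R + 2 * lam%:R + 2) * (n%:R + 2 * lam%:R + 3)).
Proof.
elim: lam => [|l IH] /=; first by rewrite -!natr1; ring.
have l1 : l%:R + 1 != 0 :> R by rewrite natr1 pnatr_eq0.
have l2 : n%:R + l%:R + 2 != 0 :> R by rewrite -!natrD pnatr_eq0 addn2.
have l3 : n%:R + l%:R + 3 != 0 :> R by rewrite -!natrD pnatr_eq0 addnS.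
have l4 : n%:R + l%:R + 4 != 0 :> R by rewrite -!natrD pnatr_eq0 addnS.
have e : sine_factor l n.+2 = sine_factor l n
   * ((n%:R + 2 * l%:R + 2) * (n%:R + 2 * l%:R + 3))
   / ((n%:R + l%:R + 2) * (n%:R + l%:R + 3)).
  by rewrite -IH mulfK // mulf_neq0.
rewrite e -[l.+1%:R]natr1 -[n.+2%:R]natr1 -[n.+1%:R]natr1.
move: (sine_factor l n) => s; move: (n%:R : R) (l%:R : R) l1 l2 l3 l4.
move=> N L l1 l2 l3 l4; field.
have -> : N + 1 + 1 + (L + 1) + 1 = N + L + 4 by ring.
have -> : N + (L + 1) + 1 = N + L + 2 by ring.
by rewrite l1 l2 l3 l4.
Qed.

(** Coefficients of [q q^(-1) = 1]: parameter 1 gives the Chebyshev polynomials of the second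
    kind. *)
Lemma gegenbauer_lam1SS n (x : R) :
  gegenbauer 1 n.+2 x = 2 * x * gegenbauer 1 n.+1 x - gegenbauer 1 n x.
Proof.
have := gegenbauer_rec 0 n.+2 x; rewrite gegenbauer_lam0 /= => h.
by move: h; set a := gegenbauer _ _ _; set b := gegenbauer _ _ _;
  set c := gegenbauer _ _ _; lra.
Qed.

Lemma gegenbauer_lam1_0 (x : R) : gegenbauer 1 0 x = 1.
Proof.
by have := gegenbauer_rec 0 0 x; rewrite gegenbauer_lam0 /= mulr0 subr0 addr0.
Qed.

Lemma gegenbauer_lam1_1 (x : R) : gegenbauer 1 1 x = 2 * x.
Proof.
have := gegenbauer_rec 0 1 x; rewrite gegenbauer_lam0 /= gegenbauer_lam1_0.
by move: (gegenbauer 1 1 x) => a; lra.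
Qed.

(* With [z = e^(i theta)] this is the finite sine expansion of
   [sin^(2 lam - 1) theta * C_n^(lam) (cos theta)]. *)
Lemma gegenbauer_pz lam n (z : R) : z != 0 ->
  (z ^+ 2 - 1) ^+ (2 * lam).+1 * z ^+ n * gegenbauer lam.+1 n ((z + z^-1) / 2) =
  sine_factor lam n * pz lam.+1 n z.
Proof.
move=> z0; elim: lam n => [|l IH] n.
  rewrite muln0 expr1 mul1r /pz big_ord1 alpha0 mul1r.
  rewrite (_ : 2 * 1 - 2 * 0 - 2 = 0)%N // muln0 addn0 expr0 muln1.
  set x := _ / 2.
  suff [] : (z ^+ 2 - 1) * z ^+ n * gegenbauer 1 n x = z ^+ (2 * n + 2) - 1 /\
    (z ^+ 2 - 1) * z ^+ n.+1 * gegenbauer 1 n.+1 x = z ^+ (2 * n.+1 + 2) - 1 by [].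
  elim: n => [|n [h1 h2]].
    rewrite gegenbauer_lam1_0 gegenbauer_lam1_1 /x; split.
      by rewrite mulr1 expr0 mulr1.
    by rewrite (_ : 2 * 1 + 2 = 4)%N // expr1; field.
  split => //; rewrite gegenbauer_lam1SS.
  transitivity ((2 * x * z) * ((z ^+ 2 - 1) * z ^+ n.+1 * gegenbauer 1 n.+1 x)
     - z ^+ 2 * ((z ^+ 2 - 1) * z ^+ n * gegenbauer 1 n x)).
    by rewrite !exprS; ring.
  rewrite h1 h2 (_ : 2 * x * z = z ^+ 2 + 1); last by rewrite /x; field.
  rewrite (_ : 2 * n.+2 + 2 = (2 * n + 2) + 2 + 2)%N; last by lia.
  rewrite (_ : 2 * n.+1 + 2 = (2 * n + 2) + 2)%N; last by lia.
  by rewrite !(exprD _ _ 2); ring.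
rewrite pz_rec; set x := _ / 2; set k := _ / _.
have := gegenbauer_raise l.+1 n x.
have IH1 := IH n; have IH2 := IH n.+2; rewrite -/x in IH1 IH2.
(* This is [sin^2 t] for [z = e^(i t)]; it supplies the two further factors [z^2 - 1]. *)
have xE : 1 - x ^+ 2 = - (z ^+ 2 - 1) ^+ 2 / (4 * z ^+ 2).
  by rewrite /x; field.
have l1 : l.+1%:R != 0 :> R by rewrite pnatr_eq0.
have l2 : n%:R + l.+1%:R + 1 != 0 :> R by rewrite -natrD natr1 pnatr_eq0.
have l3 : n%:R + l.+1%:R + 2 != 0 :> R by rewrite -!natrD addn2 pnatr_eq0.
have sh := sine_factor_shift l n.
rewrite (_ : (2 * l.+1).+1 = (2 * l).+1 + 2)%N; last by lia.
rewrite (exprD _ (2 * l).+1 2) xE => raise.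
apply: (@mulfI _ (- (l.+1%:R * (n%:R + l.+1%:R + 1)))).
  by rewrite oppr_eq0 mulf_neq0.
transitivity (z ^+ n.+2 * (z ^+ 2 - 1) ^+ (2 * l).+1 *
  (4 * l.+1%:R * (n%:R + l.+1%:R + 1) * (- (z ^+ 2 - 1) ^+ 2 / (4 * z ^+ 2)) *
        gegenbauer l.+2 n x)).
  rewrite [z ^+ n.+2]exprS [z ^+ n.+1]exprS.
  by move: (gegenbauer _ _ _) (_ ^+ (2 * l).+1) => g w; field.
rewrite raise {raise}.
transitivity ((n%:R + 2 * l.+1%:R) * (n%:R + 2 * l.+1%:R + 1) * z ^+ 2 *
   ((z ^+ 2 - 1) ^+ (2 * l).+1 * z ^+ n * gegenbauer l.+1 n x)
  - (n%:R + 1) * (n%:R + 2) *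
   ((z ^+ 2 - 1) ^+ (2 * l).+1 * z ^+ n.+2 * gegenbauer l.+1 n.+2 x)).
  rewrite [z ^+ n.+2]exprS [z ^+ n.+1]exprS.
  by move: (gegenbauer _ _ _) (gegenbauer _ _ _) (_ ^+ (2 * l).+1) => g g' w; ring.
rewrite IH1 IH2.
have e : sine_factor l n.+2 = sine_factor l n
   * ((n%:R + 2 * l.+1%:R) * (n%:R + 2 * l.+1%:R + 1))
   / ((n%:R + l.+1%:R + 1) * (n%:R + l.+1%:R + 2)).
  apply: (@mulIf _ ((n%:R + l.+1%:R + 1) * (n%:R + l.+1%:R + 2))).
    by rewrite mulf_neq0.
  rewrite divfK ?mulf_neq0 //.
  move: sh; rewrite -[l.+1%:R]natr1.
  rewrite (_ : n%:R + (l%:R + 1) + 1 = n%:R + l%:R + 2); last by ring.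
  rewrite (_ : n%:R + (l%:R + 1) + 2 = n%:R + l%:R + 3); last by ring.
  rewrite (_ : n%:R + 2 * (l%:R + 1) = n%:R + 2 * l%:R + 2); last by ring.
  by rewrite (_ : n%:R + 2 * l%:R + 2 + 1 = n%:R + 2 * l%:R + 3); last by ring.
rewrite e /k /=.
move: (pz l.+1 n z) (pz l.+1 n.+2 z) (sine_factor l n) => p p' s.
move: (l.+1%:R) (n%:R) l1 l2 l3 => L N l1 l2 l3.
by field; rewrite l1 l2 l3.
Qed.

End SineExpansion.

(** * Zeros of the Gegenbauer polynomials *)

Section GegenbauerRoots.
Context {R : realType}.

(** [gegenbauer] is defined pointwise in [x]. Here [gegenbauer_rec] is solved for [C_n^(lam+1)],
    with an outer recursion on [lam] and an inner one on the degree, to get an actual polynomial. *)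
Fixpoint gegenbauer_poly (lam : nat) : nat -> {poly R} :=
  if lam is l.+1 then
    fix g n := if n is n'.+1 then
      gegenbauer_poly l n + 2 *: ('X * g n')
      - (if n' is n''.+1 then g n'' else 0) else 1
  else fun n => (n == 0)%:R.

Lemma gegenbauer_poly_l0 lam : gegenbauer_poly lam 0 = 1.
Proof. by case: lam. Qed.

Lemma gegenbauer_polySS lam n : gegenbauer_poly lam.+1 n.+2 =
  gegenbauer_poly lam n.+2 + 2 *: ('X * gegenbauer_poly lam.+1 n.+1)
  - gegenbauer_poly lam.+1 n.
Proof. by []. Qed.

Lemma gegenbauer_poly_1 lam :
  gegenbauer_poly lam.+1 1 = gegenbauer_poly lam 1 + 2 *: 'X.
Proof. by rewrite /= mulr1 subr0. Qed.

Lemma horner_gegenbauer_poly lam n x :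
  (gegenbauer_poly lam n).[x] = gegenbauer lam n x.
Proof.
elim: lam n => [|l IH] n; first by rewrite gegenbauer_lam0 /= -polyC_natr hornerC.
have r k := gegenbauer_rec l k x.
have [] : (gegenbauer_poly l.+1 n).[x] = gegenbauer l.+1 n x /\
          (gegenbauer_poly l.+1 n.+1).[x] = gegenbauer l.+1 n.+1 x; last by [].
have e0 : (gegenbauer_poly l.+1 0).[x] = gegenbauer l.+1 0 x.
  by have := r 0%N; rewrite /= mulr0 subr0 addr0 => <-; rewrite -IH
    !gegenbauer_poly_l0.
elim: n => [|n [h1 h2]].
  split=> //; have := r 1%N.
  rewrite [shift_seq (shift_seq _) _]/= [shift_seq _ _]/=.
  rewrite -IH -e0 gegenbauer_poly_1 gegenbauer_poly_l0 hornerD hornerZ hornerX.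
  by rewrite hornerC => ->; move: (gegenbauer _ _ _) => g; ring.
split=> //; have := r n.+2; rewrite -IH [shift_seq _ n.+2]/=.
rewrite [shift_seq (shift_seq _) _]/= -h1 -h2 gegenbauer_polySS => h.
rewrite hornerD hornerN hornerD hornerZ [('X * _).[x]]hornerM hornerX h.
by move: (gegenbauer _ _ _) => g; ring.
Qed.

(** Differentiating the factor [2 x] in the recurrence for parameter [l + 1] adds [2 C_(n+1)^(l+1)],
    which turns the inherited [2 l] into [2 (l + 1)]; the rest is the recurrence one parameter
    higher. *)
Lemma deriv_gegenbauer_poly lam n : (gegenbauer_poly lam n.+1)^`() =
  (2 * lam%:R) *: gegenbauer_poly lam.+1 n.
Proof.
elim: lam n => [|l IH] n; first by rewrite mulr0 scale0r derivC.
have [] : (gegenbauer_poly l.+1 n.+1)^`() =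
            (2 * l.+1%:R) *: gegenbauer_poly l.+2 n /\
          (gegenbauer_poly l.+1 n.+2)^`() =
            (2 * l.+1%:R) *: gegenbauer_poly l.+2 n.+1; last by [].
have e1 : (gegenbauer_poly l.+1 1)^`() = (2 * l.+1%:R) *: 1.
  rewrite gegenbauer_poly_1 derivD IH derivZ derivX gegenbauer_poly_l0.
  by rewrite -scalerDl -[l.+1%:R]natr1; congr (_ *: _); ring.
elim: n => [|n [h1 h2]].
  split; first by rewrite gegenbauer_poly_l0.
  rewrite gegenbauer_polySS derivB derivD derivZ derivM derivX mul1r e1 IH.
  rewrite gegenbauer_poly_l0 derivC subr0 [gegenbauer_poly l.+2 1]gegenbauer_poly_1.
  rewrite -scalerAr mulr1.
  move: (gegenbauer_poly l.+1 1) => g.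
  rewrite !scalerDr addrA -scalerDl; congr (_ *: _ + _).
    by rewrite -natr1; ring.
  by rewrite !scalerA mulrC.
split=> //.
rewrite gegenbauer_polySS derivB derivD derivZ derivM derivX mul1r h1 h2 IH.
rewrite [in RHS]gegenbauer_polySS -scalerAr.
move: (gegenbauer_poly l.+1 n.+2) (gegenbauer_poly l.+2 n.+1) => g g1.
move: (gegenbauer_poly l.+2 n) => g2; rewrite scalerDr addrA -scalerDl.
rewrite scalerBr scalerDr; congr (_ *: _ + _ - _).
  by rewrite -[l.+1%:R]natr1; ring.
by rewrite !scalerA mulrC.
Qed.

Lemma size_gegenbauer_poly_le lam n : (size (gegenbauer_poly lam n) <= n.+1)%N.
Proof.
elim: lam n => [|l IH] n.
  by rewrite /= -polyC_natr (leq_trans (size_polyC_leq1 _)).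
have [] : (size (gegenbauer_poly l.+1 n) <= n.+1)%N /\
          (size (gegenbauer_poly l.+1 n.+1) <= n.+2)%N; last by [].
elim: n => [|n [h1 h2]].
  split; first by rewrite gegenbauer_poly_l0 size_poly1.
  rewrite gegenbauer_poly_1 (leq_trans (size_polyD _ _)) // geq_max IH /=.
  by rewrite (leq_trans (size_scale_leq _ _)) // size_polyX.
split=> //; rewrite gegenbauer_polySS.
rewrite (leq_trans (size_polyD _ _)) // geq_max size_polyN; apply/andP; split.
  rewrite (leq_trans (size_polyD _ _)) // geq_max IH /=.
  rewrite (leq_trans (size_scale_leq _ _)) // (leq_trans (size_polyMleq _ _)) //.
  by rewrite size_polyX.
by rewrite (leq_trans h1) // ltnW.
Qed.

(** Pascal's rule, [(l)_n / n!] being the binomial coefficient [l + n - 1] over [n]. *)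
Lemma pochhammer_fact_rec (l : R) n :
  pochhammer (l + 1) n.+1 / n.+1`!%:R =
  pochhammer l n.+1 / n.+1`!%:R + pochhammer (l + 1) n / n`!%:R.
Proof.
rewrite pochhammerS [pochhammer l n.+1]pochhammerSl factS natrM -natr1.
have n0 : n`!%:R != 0 :> R by rewrite pnatr_eq0 -lt0n fact_gt0.
have m0 : n%:R + 1 != 0 :> R by rewrite natr1 pnatr_eq0.
by field; rewrite n0 m0.
Qed.

Lemma coef_gegenbauer_poly lam n : (gegenbauer_poly lam n)`_n =
  2 ^+ n * (pochhammer lam%:R n / n`!%:R).
Proof.
elim: lam n => [|l IH] n.
  case: n => [|n] /=; first by rewrite coefC pochhammer0 divr1 mulr1.
  by rewrite coefC pochhammerSl !(mul0r, mulr0).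
have [] : (gegenbauer_poly l.+1 n)`_n =
            2 ^+ n * (pochhammer l.+1%:R n / n`!%:R) /\
          (gegenbauer_poly l.+1 n.+1)`_n.+1 =
            2 ^+ n.+1 * (pochhammer l.+1%:R n.+1 / n.+1`!%:R); last by [].
have e0 : (gegenbauer_poly l.+1 0)`_0 =
            2 ^+ 0 * (pochhammer l.+1%:R 0 / 0`!%:R).
  by rewrite gegenbauer_poly_l0 coefC pochhammer0 divr1 mulr1.
elim: n => [|n [h1 h2]]; (split=> //).
  rewrite gegenbauer_poly_1 coefD IH coefZ coefX -[l.+1%:R]natr1.
  by rewrite pochhammer_fact_rec pochhammer0 fact0 divr1 eqxx mulrDr divr1 !mulr1.
rewrite gegenbauer_polySS coefB coefD IH coefZ coefXM h2 /=.
rewrite [(gegenbauer_poly l.+1 n)`_n.+2]nth_default; last first.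
  by rewrite (leq_trans (size_gegenbauer_poly_le _ _)).
by rewrite subr0 -[l.+1%:R]natr1 [in RHS]pochhammer_fact_rec !exprS; ring.
Qed.

Lemma pochhammer_fact_gt0 lam n :
  0 < pochhammer (lam.+1%:R : R) n / n`!%:R.
Proof.
rewrite divr_gt0 ?ltr0n ?fact_gt0 // /pochhammer; apply: prodr_gt0 => i _.
by rewrite ltr_wpDr ?ltr0n.
Qed.

Lemma size_gegenbauer_poly lam n : size (gegenbauer_poly lam.+1 n) = n.+1.
Proof.
apply/eqP; rewrite eqn_leq size_gegenbauer_poly_le ltnNge; apply/negP => h.
have := coef_gegenbauer_poly lam.+1 n; rewrite nth_default // => /eqP.
by rewrite lt_eqF // mulr_gt0 ?exprn_gt0 ?pochhammer_fact_gt0.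
Qed.

Arguments gegenbauer_poly : simpl never.

Lemma sin_gegenbauer1 n (t : R) :
  sin t * gegenbauer 1 n (cos t) = sin (n.+1%:R * t).
Proof.
have [] : sin t * gegenbauer 1 n (cos t) = sin (n.+1%:R * t) /\
   sin t * gegenbauer 1 n.+1 (cos t) = sin (n.+2%:R * t); last by [].
elim: n => [|n [h1 h2]].
  rewrite gegenbauer_lam1_0 gegenbauer_lam1_1 mulr1 mul1r; split=> //.
  by rewrite [2 * t]mulr_natl sin_mulr2n; ring.
split=> //; rewrite gegenbauer_lam1SS mulrBr h1.
have -> : sin t * (2 * cos t * gegenbauer 1 n.+1 (cos t)) =
  2 * cos t * (sin t * gegenbauer 1 n.+1 (cos t)).
  by move: (gegenbauer _ _ _) => g; ring.
rewrite h2.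
have -> : n.+3%:R * t = n.+2%:R * t + t by rewrite -natr1; ring.
have -> : n.+1%:R * t = n.+2%:R * t - t by rewrite -[n.+2%:R]natr1; ring.
by rewrite sinB sinD; ring.
Qed.

Lemma sin_natpi k : sin (k%:R * pi) = 0 :> R.
Proof.
elim: k => [|k IH]; first by rewrite mul0r sin0.
by rewrite -natr1 mulrDl mul1r sinDpi IH oppr0.
Qed.

(** Rolle on each gap. Keeping the first root [x] apart lets the induction carry a lower bound, so
    the new roots come out strictly increasing. *)
Lemma deriv_roots (p : {poly R}) (x : R) (s : seq R) :
  path <%R x s -> all (root p) (x :: s) -> all (mem `]-1, 1[) (x :: s) ->
  exists t, [/\ size t = size s, path <%R x t, all (root p^`()) t &
    all (mem `]-1, 1[) t].
Proof.
elim: s x => [|y s IH] x; first by exists [::].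
rewrite /= => /andP[xy ys] /and3P[px py ps] /and3P[x1 y1 s1].
have [t [st yt pt t1]] := IH y ys (introT andP (conj py ps))
                                  (introT andP (conj y1 s1)).
have [c cxy dc] : exists2 c, c \in `]x, y[ & is_derive c 1 (horner p) 0.
  apply: Rolle => //.
  - by apply: continuous_subspaceT => z; exact: continuous_horner.
  - by rewrite (rootP px) (rootP py).
have c0 : root p^`() c.
  apply/rootP; have := is_derive_poly p c => d.
  by rewrite -(@derive_val _ _ _ _ _ _ _ d) (@derive_val _ _ _ _ _ _ _ dc).
move: cxy; rewrite in_itv /= => /andP[xc cy].
exists (c :: t); split=> /=.
- by rewrite st.
- rewrite xc /=; case: t yt {st pt t1} => //= z t /andP[yz ->].
  by rewrite (lt_trans cy).
- by rewrite c0.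
- rewrite t1 andbT; move: x1 y1; rewrite !inE /= => /andP[? _] /andP[_ ?].
  by apply/andP; split; [apply: lt_trans xc|apply: lt_trans cy _].
Qed.

Lemma gegenbauer_poly_roots lam n : exists s : seq R,
  [/\ size s = n, uniq s, all (root (gegenbauer_poly lam.+1 n)) s &
    all (mem `]-1, 1[) s].
Proof.
elim: lam n => [|l IH] n.
  pose th k : R := k.+1%:R * pi / n.+1%:R.
  have n1 : 0 < n.+1%:R :> R by rewrite ltr0n.
  have th_gt0 k : 0 < th k by rewrite divr_gt0 // mulr_gt0 ?ltr0n // pi_gt0.
  have th_lt k : (k < n)%N -> th k < pi.
    by move=> kn; rewrite ltr_pdivrMr // mulrC ltr_pM2l ?pi_gt0 // ltr_nat.
  exists [seq cos (th k) | k <- iota 0 n]; split.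
  - by rewrite size_map size_iota.
  - rewrite map_inj_in_uniq ?iota_uniq // => i j; rewrite !mem_iota /= => i1 j1.
    move/cos_inj; rewrite !in_itv /= !(ltW (th_gt0 _)) !(ltW (th_lt _ _)) //.
    move=> /(_ isT isT) /(mulIf (invr_neq0 (lt0r_neq0 n1))).
    by move/(mulIf (lt0r_neq0 (pi_gt0 R))) => /eqP; rewrite eqr_nat => /eqP[].
  - apply/allP => _ /mapP[k + ->]; rewrite mem_iota /= => kn.
    apply/rootP; rewrite horner_gegenbauer_poly.
    have s0 : sin (th k) != 0 by rewrite gt_eqF // sin_gt0_pi // th_gt0 th_lt.
    apply: (mulfI s0); rewrite sin_gegenbauer1 mulr0 /th mulrC divfK ?gt_eqF //.
    exact: sin_natpi.
  - apply/allP => _ /mapP[k + ->]; rewrite mem_iota /= => kn.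
    have th0 := th_gt0 k; have thp := th_lt k kn; have pi0 := pi_gt0 R.
    have c1 : cos (th k) < cos 0 by rewrite ltr_cos // in_itv /= ?lexx !ltW.
    have c2 : cos pi < cos (th k) by rewrite ltr_cos // in_itv /= ?lexx !ltW.
    by move: c1 c2; rewrite cos0 cospi => ? ?; apply/andP; split.
(* [n + 1] roots at parameter [l + 1] leave [n] for the derivative, as many as the degree of
   [C_n^(l+2)]. *)
have [s [ss us rs s1]] := IH n.+1.
pose s' := sort <=%R s.
have sl : sorted <%R s' by rewrite sort_lt_sorted.
have sz : size s' = n.+1 by rewrite size_sort.
have rs' : all (root (gegenbauer_poly l.+1 n.+1)) s' by rewrite all_sort.
have s1' : all (mem `]-1, 1[) s' by rewrite all_sort.
case: s' sl sz rs' s1' => // x s' sl [sz] rs' s1'.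
have [t [st xt rt t1]] := deriv_roots sl rs' s1'.
exists t; split=> //; first by rewrite st.
  by have /path_sorted/lt_sorted_uniq := xt.
move: rt; rewrite deriv_gegenbauer_poly; apply: sub_all => z.
by rewrite rootZ // mulf_neq0 ?pnatr_eq0.
Qed.

Lemma gegenbauer_factor lam n : exists s : seq R,
  [/\ size s = n, all (mem `]-1, 1[) s & forall x,
    gegenbauer lam.+1 n x =
    2 ^+ n * (pochhammer lam.+1%:R n / n`!%:R) * \prod_(y <- s) (x - y)].
Proof.
have [s [ss us rs s1]] := gegenbauer_poly_roots lam n.
exists s; split=> // x; rewrite -horner_gegenbauer_poly.
have -> := @all_roots_prod_XsubC _ (gegenbauer_poly lam.+1 n) s _ rs _.
- rewrite hornerZ lead_coefE size_gegenbauer_poly coef_gegenbauer_poly.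
  by rewrite horner_prod; under eq_bigr do rewrite hornerXsubC.
- by rewrite size_gegenbauer_poly ss.
- by rewrite uniq_rootsE.
Qed.

End GegenbauerRoots.

(** * Taylor coefficients of ln |p| *)

Section LogTaylor.
Context {R : realType}.

Definition log_quadratic (phi z : R) : R := ln (1 - 2 * cos phi * z + z ^+ 2).

(** Derivative of [log_quadratic phi], split into multiples of the generating function of parameter
    1 and of [z] times it, so that its coefficients can be read off. *)
Let dlog (phi z : R) : R :=
  - (2 * cos phi) * (1 - 2 * cos phi * z + z ^+ 2) ^- 1
  + 2 * (z * (1 - 2 * cos phi * z + z ^+ 2) ^- 1).

Let f1 (phi z : R) : R := (1 - 2 * cos phi * z + z ^+ 2) ^- 1.

Let rf1 phi : rational_near0 (f1 phi).
Proof. exact: rational_near0_quadraticV. Qed.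

Let rZf1 phi c : rational_near0 (fun z => c * f1 phi z).
Proof. by apply: rational_near0M => //; exact: rational_near0_cst. Qed.

Let rXf1 phi : rational_near0 (fun z => z * f1 phi z).
Proof. by apply: rational_near0M => //; exact: rational_near0_id. Qed.

Let rZXf1 phi c : rational_near0 (fun z => c * (z * f1 phi z)).
Proof. by apply: rational_near0M => //; exact: rational_near0_cst. Qed.

Lemma rational_near0_dlog phi : rational_near0 (dlog phi).
Proof. exact: (rational_near0D (rZf1 _ _) (rZXf1 _ _)). Qed.

(** In Chebyshev terms, [- 2 cos phi U_n + 2 U_(n-1) = - 2 T_(n+1)]. Both sides obey the same
    second-order recurrence, so two consecutive indices are carried. *)
Lemma taylor_coef_dlog phi n :
  taylor_coef n (dlog phi) = - 2 * cos (n.+1%:R * phi).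
Proof.
have -> : taylor_coef n (dlog phi) = - (2 * cos phi) * gegenbauer 1 n (cos phi)
    + 2 * shift_seq (gegenbauer 1 ^~ (cos phi)) n.
  rewrite (taylor_coefD n (rZf1 phi _) (rZXf1 phi _)).
  by rewrite (taylor_coefZ _ _ (rf1 _)) (taylor_coefZ _ _ (rXf1 _)) taylor_coef_mulX.
have [] : - (2 * cos phi) * gegenbauer 1 n (cos phi)
    + 2 * shift_seq (gegenbauer 1 ^~ (cos phi)) n = - 2 * cos (n.+1%:R * phi) /\
   - (2 * cos phi) * gegenbauer 1 n.+1 (cos phi)
    + 2 * shift_seq (gegenbauer 1 ^~ (cos phi)) n.+1 = - 2 * cos (n.+2%:R * phi);
  last by [].
elim: n => [|n [h1 h2]].
  rewrite /= gegenbauer_lam1_0 gegenbauer_lam1_1 mulr0 mul1r; split; first by ring.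
  by rewrite [2%:R * phi]mulr_natl cos_mulr2n -mulr_natl; ring.
split=> //.
have -> : n.+3%:R * phi = n.+2%:R * phi + phi by rewrite -[n.+3%:R]natr1; ring.
have e : n.+1%:R * phi = n.+2%:R * phi - phi by rewrite -[n.+2%:R]natr1; ring.
rewrite cosD.
transitivity (2 * cos phi * (- 2 * cos (n.+2%:R * phi))
               - (- 2 * cos (n.+1%:R * phi))); last by rewrite e cosB; ring.
rewrite -h1 -h2 [shift_seq _ n.+1]/= [shift_seq _ n.+2]/= gegenbauer_lam1SS.
case: n {h1 h2 e} => [|n].
  rewrite gegenbauer_lam1_0 gegenbauer_lam1_1 /=.
  by move: (cos phi) => x; ring.
rewrite [shift_seq _ n.+1]/= !gegenbauer_lam1SS.
move: (cos phi) (gegenbauer 1 n.+1 _) (gegenbauer 1 n _) => x g g'.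
by ring.
Qed.

Lemma quadratic_near_gt0 (phi : R) :
  \forall z \near 0, 0 < 1 - 2 * cos phi * z + z ^+ 2.
Proof.
pose P : {poly R} := 1 - (2 * cos phi) *: 'X + 'X ^+ 2.
have PE z : P.[z] = 1 - 2 * cos phi * z + z ^+ 2 by rewrite /P !hornerE.
have P0 : 0 < P.[0] by rewrite PE mulr0 expr0n subr0 addr0 ltr01.
have /cvgr_gt := @continuous_horner R P 0; move=> /(_ _ P0).
by apply: filterS => z; rewrite PE.
Qed.

Lemma is_derive_log_quadratic (phi z : R) : 0 < 1 - 2 * cos phi * z + z ^+ 2 ->
  is_derive z 1 (log_quadratic phi) (dlog phi z).
Proof.
move=> q0.
pose P : {poly R} := 1 - (2 * cos phi) *: 'X + 'X ^+ 2.
have PE t : P.[t] = 1 - 2 * cos phi * t + t ^+ 2 by rewrite /P !hornerE.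
have -> : log_quadratic phi = @ln R \o (horner P).
  by apply/funext => t; rewrite /log_quadratic /= PE.
have dP := is_derive_poly P z.
have dl : is_derive P.[z] 1 (@ln R) (P.[z])^-1 by apply: is_derive1_ln; rewrite PE.
have := is_derive1_comp dl dP => d.
apply: is_derive_eq.
rewrite /dlog PE.
have -> : P^`().[z] = 2 * (z - cos phi).
  rewrite /P expr2 !(derivD, derivN, derivZ, derivM, derivX, derivC).
  by rewrite !(hornerD, hornerN, hornerZ, hornerM, hornerX, hornerC); ring.
by rewrite expr1; move: (_^-1) => y; ring.
Qed.

(** The calculus of [rational_near0] applies to the derivative of the logarithm, not to the
    logarithm, so one derivative is peeled off first; hence the order [k.+1]. *)
Lemma taylor_coef_sum_log (s : seq R) (c w : R) k :
  taylor_coef k.+1 (fun z => c + w * \sum_(phi <- s) log_quadratic phi z) =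
  - 2 * w / k.+1%:R * \sum_(phi <- s) cos (k.+1%:R * phi).
Proof.
have d : \forall z \near 0,
    is_derive (z : R) 1 (fun z => c + w * \sum_(phi <- s) log_quadratic phi z)
      (w * \sum_(phi <- s) dlog phi z).
  elim: s => [|phi s IH].
    near=> z; rewrite big_nil mulr0.
    rewrite (_ : (fun _ => _) = cst c); first exact: is_derive_cst.
    by apply/funext => t; rewrite big_nil mulr0 addr0.
  have q0 := quadratic_near_gt0 phi.
  apply: filterS2 q0 IH => z /is_derive_log_quadratic d1 d2.
  rewrite big_cons (_ : (fun _ => _) = w *: log_quadratic phi +
    (fun z => c + w * \sum_(phi <- s) log_quadratic phi z)); last first.
    by apply/funext => t; rewrite big_cons mulrDr addrCA.
  by rewrite mulrDr; apply: is_deriveD.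
rewrite taylor_coefS (@taylor_coef_near_eq _ _ _
  (fun z => w * \sum_(phi <- s) dlog phi z)); last first.
  by apply: filterS d => z d; rewrite derive1E derive_val.
have [r e] : rational_near0 (fun z => \sum_(phi <- s) dlog phi z) /\
  taylor_coef k (fun z => \sum_(phi <- s) dlog phi z) =
  \sum_(phi <- s) (- 2 * cos (k.+1%:R * phi)).
  elim: s {d} => [|phi s [r IH]].
    have r0 := @rational_near0_cst R 0.
    rewrite (_ : (fun _ => _) = (fun=> 0)); last first.
      by apply/funext => z; rewrite big_nil.
    split=> //; rewrite big_nil.
    transitivity (0 * taylor_coef k (fun _ : R => 0 : R)); last by rewrite mul0r.
    rewrite -(taylor_coefZ _ _ r0); congr (taylor_coef _ _).
    by apply/funext => z; rewrite mul0r.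
  rewrite (_ : (fun _ => _) =
    (fun z => dlog phi z + (fun z => \sum_(phi <- s) dlog phi z) z)); last first.
    by apply/funext => t; rewrite big_cons.
  have rd := rational_near0_dlog phi.
  split; first exact: (rational_near0D rd r).
  by rewrite (taylor_coefD _ rd r) IH taylor_coef_dlog big_cons.
by rewrite (taylor_coefZ _ _ r) e -mulr_sumr; ring.
Unshelve. all: by end_near. Qed.

Lemma ln_prod (I : eqType) (s : seq I) (F : I -> R) :
  {in s, forall i, 0 < F i} -> ln (\prod_(i <- s) F i) = \sum_(i <- s) ln (F i).
Proof.
elim: s => [|i s IH] F0; first by rewrite !big_nil ln1.
have F0' : {in s, forall i, 0 < F i} by move=> j js; rewrite F0 // inE js orbT.
rewrite !big_cons lnM ?IH // posrE ?F0 ?mem_head //.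
by rewrite big_seq; apply: prodr_gt0 => j /F0'.
Qed.

(** [gegenbauer_pz] involves [z^-1], whereas Taylor coefficients are taken at 0. A nonzero
    difference would have too many roots, here among the positive integers. *)
Lemma horner_eq_off0 (P Q : {poly R}) :
  (forall z, z != 0 -> P.[z] = Q.[z]) -> P = Q.
Proof.
move=> h; apply/eqP; rewrite -subr_eq0; apply/negPn/negP => D0.
pose rs : seq R := [seq k.+1%:R | k <- iota 0 (size (P - Q))].
have rr : all (root (P - Q)) rs.
  apply/allP => _ /mapP[k _ ->]; rewrite rootE hornerD hornerN subr_eq0.
  by rewrite h // pnatr_eq0.
have ur : uniq rs.
  by rewrite map_inj_uniq ?iota_uniq // => a b /eqP; rewrite eqr_nat => /eqP[].
by have := max_poly_roots D0 rr ur; rewrite size_map size_iota ltnn.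
Qed.

(** At [x = (z + 1/z) / 2] each factor is [x - y = (1 - 2 y z + z^2) / (2 z)], and the resulting
    [(2 z)^n] cancels [2^n] and [z^n]. *)
Lemma pz_factor lam n (s : seq R) : size s = n ->
  (forall x, gegenbauer lam.+1 n x =
    2 ^+ n * (pochhammer lam.+1%:R n / n`!%:R) * \prod_(y <- s) (x - y)) ->
  exists2 c : R, c != 0 & forall z, pz lam.+1 n z =
    c * (z ^+ 2 - 1) ^+ (2 * lam).+1 * \prod_(y <- s) (1 - 2 * y * z + z ^+ 2).
Proof.
move=> ss sE; have k0 := @sine_factor_neq0 R lam n.
set b := pochhammer lam.+1%:R n / n`!%:R in sE.
exists (b / sine_factor lam n) => [|z].
  by rewrite mulf_neq0 ?invr_eq0 // gt_eqF // pochhammer_fact_gt0.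
pose P : {poly R} := \sum_(nu < lam.+1) alpha lam.+1 nu n *:
   ('X ^+ (2 * n + 2 * lam.+1 + 2 * nu) - 'X ^+ (2 * lam.+1 - 2 * nu - 2)).
have PE t : P.[t] = pz lam.+1 n t.
  rewrite /P horner_sum; apply: eq_bigr => i _.
  by rewrite hornerZ hornerD hornerN !hornerXn.
pose Q : {poly R} := (b / sine_factor lam n) *: (('X ^+ 2 - 1) ^+ (2 * lam).+1
  * \prod_(y <- s) (1 - (2 * y) *: 'X + 'X ^+ 2)).
have QE t : Q.[t] = b / sine_factor lam n * (t ^+ 2 - 1) ^+ (2 * lam).+1
    * \prod_(y <- s) (1 - 2 * y * t + t ^+ 2).
  rewrite /Q hornerZ hornerM horner_exp horner_prod hornerD hornerN hornerXn.
  rewrite hornerC mulrA; congr (_ * _); apply: eq_bigr => y _.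
  by rewrite !hornerE.
rewrite -PE -QE (@horner_eq_off0 P Q) // => t t0.
rewrite PE QE; apply: (mulfI k0); rewrite -gegenbauer_pz // sE.
have -> : \prod_(y <- s) ((t + t^-1) / 2 - y) =
   (2 * t) ^- n * \prod_(y <- s) (1 - 2 * y * t + t ^+ 2).
  rewrite -ss; elim: s {ss sE Q QE} => [|y s IH].
    by rewrite !big_nil expr0 invr1 mulr1.
  rewrite !big_cons IH /= [(2 * t) ^+ _.+1]exprS invfM.
  set u := _ ^- _; set p := \prod_(_ <- _) _.
  by move: u p => u p; field.
set p := \prod_(_ <- _) _; rewrite exprMn invfM.
have t2 : 2 ^+ n != 0 :> R by rewrite expf_neq0.
have tn : t ^+ n != 0 by rewrite expf_neq0.
move: p (2 ^+ n) t2 (t ^+ n) tn ((t ^+ 2 - 1) ^+ _) (sine_factor lam n) k0.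
move=> p u u0 v v0 w k k0.
by field; rewrite ?k0 ?u0 ?v0.
Qed.

Lemma taylor_coef_ln_pz lam n (s : seq R) k : size s = n ->
  all (mem `]-1, 1[) s ->
  (forall x, gegenbauer lam.+1 n x =
    2 ^+ n * (pochhammer lam.+1%:R n / n`!%:R) * \prod_(y <- s) (x - y)) ->
  taylor_coef k.+1 (fun z => ln `|pz lam.+1 n z|) =
  - ((2 * lam).+1%:R * (1 + cos (k.+1%:R * pi))
     + 2 * \sum_(y <- s) cos (k.+1%:R * acos y)) / k.+1%:R.
Proof.
move=> ss s1 sE; have [c c0 pzE] := pz_factor ss sE.
pose m := (2 * lam).+1.
pose phis := [seq acos y | y <- s].
(* Squaring [p] removes the sign and gives [(z^2 - 1)^2 = (1 - 2 z + z^2) (1 + 2 z + z^2)], that is,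
   the angles 0 and [pi], [m] times each; every [acos y] then occurs twice. The later factor [2^-1]
   undoes the squaring. *)
pose S := nseq m 0 ++ nseq m pi ++ phis ++ phis.
have pz2 z : pz lam.+1 n z ^+ 2 =
    c ^+ 2 * \prod_(phi <- S) (1 - 2 * cos phi * z + z ^+ 2).
  rewrite pzE /S !big_cat !big_nseq !iter_mulr !mulr1 cos0 cospi /= big_map.
  have -> : \prod_(j <- s) (1 - 2 * cos (acos j) * z + z ^+ 2) =
    \prod_(y <- s) (1 - 2 * y * z + z ^+ 2).
    apply: eq_big_seq => y /(allP s1) /andP[y1 y2]; rewrite acosK // in_itv /=.
    by rewrite !ltW.
  rewrite [in RHS]mulrA -exprMn.
  have -> : (1 - 2 * 1 * z + z ^+ 2) * (1 - 2 * -1 * z + z ^+ 2) =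
    (z ^+ 2 - 1) ^+ 2 by ring.
  rewrite [(z ^+ 2 - 1) ^+ 2 ^+ m]exprAC -/m.
  by move: ((z ^+ 2 - 1) ^+ m) => w; ring.
have q0 : \forall z \near 0,
   {in S, forall phi, 0 < 1 - 2 * cos phi * (z : R) + z ^+ 2}.
  elim: S {pz2} => [|phi S IH]; first by near=> z.
  have h := quadratic_near_gt0 phi.
  apply: filterS2 h IH => z h1 h2 psi; rewrite inE => /predU1P[-> //|]; exact: h2.
rewrite (@taylor_coef_near_eq _ _ _
  (fun z => ln (c ^+ 2) / 2 + 2^-1 * \sum_(phi <- S) log_quadratic phi z)).
  rewrite taylor_coef_sum_log /S !big_cat !big_nseq !iter_addr !addr0 /= big_map.
  rewrite mulr0 cos0 -[1 *+ m]mulr_natl -[cos _ *+ m]mulr_natl -/m.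
  by field; rewrite addrC natr1 pnatr_eq0.
apply: filterS q0 => z q0.
have pr0 : 0 < \prod_(phi <- S) (1 - 2 * cos phi * z + z ^+ 2).
  by rewrite big_seq; apply: prodr_gt0 => phi /q0.
have c2 : 0 < c ^+ 2 by rewrite exprn_even_gt0.
have p0 : 0 < `|pz lam.+1 n z|.
  rewrite normr_gt0; apply/eqP => p0; move: (pz2 z); rewrite p0 expr0n /=.
  by move/eqP; rewrite lt_eqF // mulr_gt0.
have : ln (`|pz lam.+1 n z| ^+ 2) = ln (c ^+ 2)
    + \sum_(phi <- S) log_quadratic phi z.
  by rewrite real_normK ?num_real // pz2 lnM ?posrE // ln_prod.
by rewrite (lnXn 2 p0) mulr2n => h; lra.
Unshelve. all: by end_near. Qed.

End LogTaylor.

(** * Integrals over segments *)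

Section HasIntegral.
Context {R : realType}.
Notation mu := (@lebesgue_measure R).
Implicit Types (f g F : R -> R) (a b c k u v : R).
Local Open Scope classical_set_scope.

(** Measurability is asked on the whole line so that restriction, concatenation and substitution
    need not track domains; integrability is bundled because the value alone does not give
    linearity. *)
Definition has_int a b f v : Prop :=
  [/\ measurable_fun [set: R] f, mu.-integrable `[a, b] (EFin \o f) &
      (\int[mu]_(x in `[a, b]) (f x)%:E = v%:E)%E].

Lemma has_int_unique a b f u v : has_int a b f u -> has_int a b f v -> u = v.
Proof. by move=> [_ _ hu] [_ _]; rewrite hu => -[]. Qed.

Lemma integrable_has_int a b f : measurable_fun [set: R] f ->
  mu.-integrable `[a, b] (EFin \o f) -> exists v, has_int a b f v.
Proof.
move=> mf fi; exists (fine (\int[mu]_(x in `[a, b]) (f x)%:E)%E); split=> //.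
by rewrite fineK //; exact: integrable_fin_num.
Qed.

Lemma has_intD a b f g u v : has_int a b f u -> has_int a b g v ->
  has_int a b (fun x => f x + g x) (u + v).
Proof.
move=> [mf fi fu] [mg gi gv]; split.
- exact: measurable_funD.
- rewrite (_ : EFin \o _ = (EFin \o f) \+ (EFin \o g))%E //.
  exact: integrableD.
- rewrite EFinD -fu -gv -integralD_EFin //.
Qed.

Lemma has_intZ a b f k v : has_int a b f v ->
  has_int a b (fun x => k * f x) (k * v).
Proof.
move=> [mf fi fv]; split.
- exact: measurable_funM.
- rewrite (_ : EFin \o _ = (fun x => k%:E * (EFin \o f) x))%E //.
  exact: integrableZl.
- by rewrite EFinM -fv -integralZl.
Qed.

Lemma has_int_sum (I : eqType) (s : seq I) a b (f : I -> R -> R) (v : I -> R) :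
  {in s, forall i, has_int a b (f i) (v i)} ->
  has_int a b (fun x => \sum_(i <- s) f i x) (\sum_(i <- s) v i).
Proof.
elim: s => [|i s IH] h.
  rewrite big_nil (_ : (fun _ => _) = cst 0); last first.
    by apply/funext => x; rewrite big_nil.
  split; first exact: measurable_cst.
    exact: integrable0.
  by rewrite integral0.
rewrite big_cons (_ : (fun _ => _) = (fun x => f i x + \sum_(i <- s) f i x)).
  apply: has_intD; first by apply: h; rewrite mem_head.
  by apply: IH => j js; apply: h; rewrite inE js orbT.
by apply/funext => x; rewrite big_cons.
Qed.

Lemma has_int_cat a b c f u v : a <= b -> b <= c ->
  has_int a b f u -> has_int b c f v -> has_int a c f (u + v).
Proof.
move=> ab bc [mf fab fu] [_ fbc fv].
have mE : measurable_fun [set: R] (EFin \o f) by exact/measurable_EFinP.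
have e : `[a, c] = `[a, b[ `|` `[b, c] :> set R.
  by rewrite -itv_bndbnd_setU // bnd_simp.
have dj : [disjoint `[a, b[ & `[b, c]] :> Prop.
  apply/disj_setPRL => x /=; rewrite !in_itv /= => /andP[bx _].
  by apply/negP; rewrite negb_and -!leNgt bx orbT.
have split_int (h : R -> \bar R) : measurable_fun [set: R] h ->
  (\int[mu]_(x in `[a, c]) h x =
   \int[mu]_(x in `[a, b]) h x + \int[mu]_(x in `[b, c]) h x)%E.
  move=> mh; rewrite e integral_setU //=; last exact: measurable_funTS.
  by congr (_ + _)%E; apply: integral_itv_bndo_bndc; exact: measurable_funTS.
split=> //.
- apply/integrableP; split; first exact: measurable_funTS.
  rewrite (split_int (fun x => `|(EFin \o f) x|)%E); last exact: measurableT_comp.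
  move/integrableP : fab => [_ ?]; move/integrableP : fbc => [_ ?].
  exact: lte_add_pinfty.
- by rewrite (split_int (EFin \o f)) // EFinD -fu -fv.
Qed.

Lemma has_intS a b a' b' f v : a <= a' -> b' <= b -> has_int a b f v ->
  exists v', has_int a' b' f v'.
Proof.
move=> aa bb [mf fi _]; apply: integrable_has_int => //.
apply: integrableS fi => //=.
by apply: subset_itv; rewrite bnd_simp.
Qed.

(** A finite set is null. The exceptions are points where a logarithm meets 0: there the convention
    [ln 0 = 0] breaks the algebraic identities. *)
Lemma has_int_eq_off (N : seq R) a b f g v : measurable_fun [set: R] g ->
  (forall x, a <= x <= b -> x \notin N -> g x = f x) ->
  has_int a b f v -> has_int a b g v.
Proof.
move=> mg fg [mf fi fv].
have mEf : measurable_fun [set: R] (EFin \o f) by exact/measurable_EFinP.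
have mEg : measurable_fun [set: R] (EFin \o g) by exact/measurable_EFinP.
have N0 : mu [set` N] = 0%E.
  apply: countable_lebesgue_measure0; exact/finite_set_countable/finite_seq.
have mN : measurable ([set` N] : set R).
  apply: countable_measurable; first by move=> t; exact: measurable_set1.
  exact/finite_set_countable/finite_seq.
have ae (h h' : R -> \bar R) :
  (forall x, a <= x <= b -> x \notin N -> h x = h' x) -> ae_eq mu `[a, b] h h'.
  move=> hh; exists [set` N]; split => // x /= /not_implyP[].
  rewrite in_itv /= => xab hx; apply: contrapT => /negP xN; exact/hx/hh.
split=> //.
- apply/integrableP; split; first exact: measurable_funTS.
  move/integrableP : fi => [_]; congr (_ < _)%E; apply: ae_eq_integral => //.
  + by apply: measurable_funTS; exact: measurableT_comp.
  + by apply: measurable_funTS; exact: measurableT_comp.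
  + by apply: ae => x xab xN /=; rewrite fg.
- rewrite -fv; apply: ae_eq_integral => //; [exact: measurable_funTS..|].
  by apply: ae => x xab xN /=; rewrite fg.
Qed.

Section Affine.
Variables (k c : R).
Hypothesis k0 : k != 0.
Let phi (x : measurableTypeR R) : measurableTypeR R := k * x + c.

Let mphi : measurable_fun setT phi.
Proof. by apply: measurable_funD => //; exact: measurable_funM. Qed.

(* The measure structure of [pushforward mu phi] depends on [mphi], which
   canonical structure inference does not find. *)
Let nu : {measure set (measurableTypeR R) -> \bar R} :=
  mscale (NngNum (normr_ge0 k))
   (measure_function_pushforward__canonical__measure_function_Measure mu mphi).

(** Half-open intervals determine Lebesgue measure. For [k < 0] the preimage is half-open on the
    other side, which leaves its length unchanged. *)
Lemma lebesgue_measure_affine (A : set (measurableTypeR R)) :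
  measurable A -> mu A = nu A.
Proof.
apply: lebesgue_measure_unique => _ [[x y] _ <-] /=.
rewrite /nu /mscale /= /pushforward.
have [k1|k1] := ltP 0 k.
  have -> : phi @^-1` `]x, y] = `](x - c) / k, (y - c) / k].
    apply/seteqP; split=> t /=; rewrite !in_itv /= /phi;
    by rewrite ltr_pdivrMr // ler_pdivlMr // ltrBlDr lerBrDr (mulrC t).
  rewrite !lebesgue_measure_itv /= !lte_fin ltr_pM2r ?invr_gt0 // ltrD2r.
  case: ifPn => _; last by rewrite mule0.
  by rewrite -!EFinD -EFinM gtr0_norm //; congr EFin; field.
have k2 : k < 0 by rewrite lt_neqAle k0.
have -> : phi @^-1` `]x, y] = `[(y - c) / k, (x - c) / k[.
  apply/seteqP; split=> t /=; rewrite !in_itv /= /phi andbC;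
  by rewrite ltr_ndivlMr // ler_ndivrMr // ltrBlDr lerBrDr (mulrC t).
rewrite !lebesgue_measure_itv /= !lte_fin ltr_nM2r ?invr_lt0 // ltrD2r.
case: ifPn => _; last by rewrite mule0.
by rewrite -!EFinD -EFinM ltr0_norm //; congr EFin; field.
Qed.

(** The endpoint hypothesis describes the preimage of the segment and so covers both signs of [k].
    The formula is obtained for nonnegative functions, then applied to positive and negative
    parts. *)
Lemma has_int_affine a b a' b' f v :
  (forall x, (a <= k * x + c <= b) = (a' <= x <= b')) ->
  has_int a b f v -> has_int a' b' (fun x => f (k * x + c)) (v / `|k|).
Proof.
move=> itvE [mf fi fv].
have mEf : measurable_fun [set: R] (EFin \o f) by exact/measurable_EFinP.
have pE : phi @^-1` `[a, b] = `[a', b'].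
  by apply/seteqP; split=> t /=; rewrite !in_itv /= -itvE.
have nu_eq (h : R -> \bar R) :
   (\int[mu]_(x in `[a, b]) h x = \int[nu]_(x in `[a, b]) h x)%E.
  by apply: eq_measure_integral => A mA _; exact: lebesgue_measure_affine.
have ge0_int (h : R -> \bar R) : measurable_fun [set: R] h ->
  (forall x, 0 <= h x)%E ->
  (\int[mu]_(x in `[a, b]) h x = `|k|%:E * \int[mu]_(x in `[a', b']) h (phi x))%E.
  move=> mh h0; rewrite nu_eq ge0_integral_mscale //=; last exact: measurable_funTS.
  by rewrite ge0_integral_pushforward //= ?pE //; exact: measurable_funTS.
have kpos : 0 < `|k| by rewrite normr_gt0.
have intfphi : mu.-integrable `[a', b'] (EFin \o (fun x => f (k * x + c))).
  apply/integrableP; split.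
    by apply: measurable_funTS; exact: (measurableT_comp mEf mphi).
  move/integrableP : fi => [_].
  have mabs : measurable_fun [set: R] (abse \o (EFin \o f)).
    exact: measurableT_comp.
  rewrite (ge0_int (abse \o (EFin \o f)) mabs) => [|x]; last exact: abse_ge0.
  rewrite -[X in _ -> (X < _)%E]/(\int[mu]_(x in `[a', b'])
    (abse \o (EFin \o f)) (phi x))%E.
  move: (integral _ _ _) => X; apply: contraTT.
  by rewrite -!leNgt !leye_eq => /eqP ->; rewrite gt0_muley ?lte_fin.
split=> //; first exact: (measurableT_comp mf mphi).
set h := EFin \o _ in intfphi.
have fin_pos : (\int[mu]_(x in `[a', b']) h^\+ x \is a fin_num)%E.
  exact: integrable_pos_fin_num.
have fin_neg : (\int[mu]_(x in `[a', b']) h^\- x \is a fin_num)%E.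
  exact: integrable_neg_fin_num.
have fin_h : (\int[mu]_(x in `[a', b']) h x \is a fin_num)%E.
  exact: integrable_fin_num.
have : (v%:E = `|k|%:E * \int[mu]_(x in `[a', b']) h x)%E.
  rewrite -fv [LHS]integralE [X in _ = (_ * X)%E]integralE.
  rewrite (ge0_int (EFin \o f)^\+%E) //; last exact: measurable_funepos.
  rewrite (ge0_int (EFin \o f)^\-%E) //; last exact: measurable_funeneg.
  rewrite [RHS]muleBr //; last by apply: fin_num_adde_defl; rewrite fin_numN.
  by congr (_ * _ - _ * _)%E; apply: eq_integral => x _; rewrite ?funeposE ?funenegE.
rewrite -[X in _ -> X = _]/(\int[mu]_(x in `[a', b']) h x)%E.
rewrite -(fineK fin_h) -EFinM => -[->]; congr EFin.
by rewrite mulrAC divff ?mul1r // normr_eq0.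
Qed.

End Affine.
End HasIntegral.

(** * The fundamental theorem of calculus with singular endpoints *)

Section FundamentalTheorem.
Context {R : realType}.
Notation mu := (@lebesgue_measure R).
Implicit Types (f F : R -> R) (a b : R).
Local Open Scope classical_set_scope.

Lemma is_derive_continuous F (x d : R) :
  is_derive x 1 F d -> {for x, continuous F}.
Proof. by move=> [h _]; exact/differentiable_continuous/derivable1_diffP. Qed.

(** [F] minus the integral of [f] from [a] is continuous on the segment with zero derivative inside,
    hence takes equal values at both ends. Continuity of [f] is asked only inside, which allows a
    singularity such as that of [log_sine] at 0. *)
Lemma has_int_FTC a b f F : a < b -> measurable_fun [set: R] f ->
  mu.-integrable `[a, b] (EFin \o f) ->
  (forall x, a < x < b -> {for x, continuous f}) ->
  {within `[a, b], continuous F} ->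
  (forall x, a < x < b -> is_derive x 1 F (f x)) ->
  has_int a b f (F b - F a).
Proof.
move=> ab mf fi cf cF dF; split=> //.
pose G x := parameterized_integral mu a x f.
have cG : {within `[a, b], continuous G}.
  exact: (parameterized_integral_continuous (ltW ab) fi).
have dG x : a < x < b -> is_derive x 1 G (f x).
  move=> /[dup] axb /andP[ax xb].
  have [d1 d2] := continuous_FTC1_closed xb fi ax (cf x axb).
  by apply: DeriveDef; [exact: d1|rewrite -derive1E; exact: d2].
have [c _] : exists2 c, c \in `]a, b[%R &
    (F b - G b) - (F a - G a) = (fun=> 0) c * (b - a).
  apply: (@MVT _ (fun x => F x - G x) (fun=> 0)) => //.
    move=> x; rewrite in_itv /= => axb.
    have := dF x axb; have := dG x axb => d1 d2.
    by rewrite -(subrr (f x)); apply: is_deriveB.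
  by move=> x; apply: continuousB; [exact: cF|exact: cG].
rewrite mul0r => e.
have Ga : G a = 0 by rewrite /G /parameterized_integral set_itv1 Rintegral_set1.
have Gb : G b = F b - F a by move: e; rewrite Ga; lra.
by rewrite -Gb /G /parameterized_integral /Rintegral fineK //;
  exact: integrable_fin_num.
Qed.

Lemma has_int_derive a b f F : a <= b -> measurable_fun [set: R] f ->
  (forall x, a <= x <= b -> {for x, continuous f}) ->
  (forall x, a <= x <= b -> is_derive x 1 F (f x)) ->
  has_int a b f (F b - F a).
Proof.
move=> ab mf cf dF.
have sub x : a < x < b -> a <= x <= b.
  by move=> /andP[ax xb]; rewrite !ltW.
have within_cont h : (forall x, a <= x <= b -> {for x, continuous h}) ->
    {within `[a, b], continuous (h : R -> R)}.
  move=> ch; apply: continuous_in_subspaceT => x; rewrite inE /= in_itv /=.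
  exact: ch.
have fi : mu.-integrable `[a, b] (EFin \o f).
  apply: continuous_compact_integrable; first exact: segment_compact.
  exact: within_cont.
move: ab; rewrite le_eqVlt => /predU1P[e|ab]; last first.
  apply: has_int_FTC => //.
  - by move=> x /sub; exact: cf.
  - by apply: within_cont => x /dF; exact: is_derive_continuous.
  - by move=> x /sub; exact: dF.
by split=> //; rewrite -e set_itv1 integral_set1 subrr.
Qed.

(** Monotone convergence along segments increasing to []a, b]], on which the integrals stay below
    [M]; the point [a] is null. *)
Lemma integrable_left_improper a b f (M : R) : a < b ->
  measurable_fun [set: R] f -> (forall x, a < x <= b -> 0 <= f x) ->
  (forall e, a < e < b -> exists2 v, has_int e b f v & v <= M) ->
  mu.-integrable `[a, b] (EFin \o f).
Proof.
move=> ab mf f0 fM.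
have mEf : measurable_fun [set: R] (EFin \o f) by exact/measurable_EFinP.
have mabs : measurable_fun [set: R] (fun x => `|(EFin \o f) x|)%E.
  exact: measurableT_comp.
apply/integrableP; split; first exact: measurable_funTS.
rewrite -integral_itv_obnd_cbnd; last exact: measurable_funTS.
(* [n.+2] keeps [e n] strictly below [b] already at [n = 0]. *)
pose e (n : nat) := a + (b - a) / n.+2%:R.
have ba : 0 < b - a by rewrite subr_gt0.
have ae n : a < e n by rewrite ltrDl divr_gt0 // ltr0n.
have eb n : e n < b.
  rewrite /e -ltrBrDl ltr_pdivrMr ?ltr0n // ltr_pMr //.
  by rewrite ltr1n.
pose D n : set R := `[e n, b].
have DE : `]a, b] = \bigcup_n D n.
  apply/seteqP; split=> x /=.
    rewrite in_itv /= => /andP[ax xb].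
    have [n hn] : exists n : nat, (b - a) / (x - a) < n%:R.
      exists (Num.truncn ((b - a) / (x - a))).+1.
      by rewrite truncnS_gt // num_real.
    exists n => //; rewrite /D /= in_itv /= xb andbT /e -lerBrDl.
    rewrite ler_pdivrMr ?ltr0n //.
    have xa : 0 < x - a by rewrite subr_gt0.
    move: hn; rewrite ltr_pdivrMr // mulrC => /ltW /le_trans; apply.
    by rewrite ler_pM2l // ler_nat; lia.
  move=> [n _]; rewrite /D /= !in_itv /= => /andP[ex ->]; rewrite andbT.
  exact: lt_le_trans ex.
rewrite DE.
have nd : nondecreasing_seq D.
  apply/nondecreasing_seqP => n; rewrite subsetEset; apply: subset_itvr.
  rewrite bnd_simp lerD2l ler_pM2l // lef_pV2 ?posrE ?ltr0n // ler_nat; lia.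
have cvgD : (\int[mu]_(x in D n) `|(EFin \o f) x| @[n --> \oo] -->
             \int[mu]_(x in \bigcup_n D n) `|(EFin \o f) x|)%E.
  apply: ge0_nondecreasing_set_cvg_integral => // n.
    exact: measurable_itv.
  exact: measurable_funTS.
rewrite -(cvg_lim _ cvgD) //.
apply: (@le_lt_trans _ _ M%:E); last exact: ltry.
apply: lime_le; first by apply/cvg_ex; eexists; exact: cvgD.
near=> n.
have [|v [_ _ fv] vM] := fM (e n); first by rewrite ae eb.
suff -> : (\int[mu]_(x in D n) `|(EFin \o f) x| = v%:E)%E by rewrite lee_fin.
rewrite -fv; apply: eq_integral => x.
rewrite inE /D /= in_itv /= => /andP[ex xb]; rewrite ger0_norm // f0 //.
by rewrite xb andbT (lt_le_trans (ae n)).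
Unshelve. all: by end_near. Qed.

End FundamentalTheorem.

(** * Fourier coefficients of ln |2 sin (u / 2)| *)

Section LogSine.
Context {R : realType}.
Notation mu := (@lebesgue_measure R).
Implicit Types (u k : R) (j : nat).

Definition log_sine u : R := ln `|2 * sin (2^-1 * u)|.

Let is_derive_scale k u : is_derive u 1 (fun x => k * x) k.
Proof.
have : is_derive u 1 (k *: id) (k *: 1) by apply: is_deriveZ.
by rewrite /GRing.scale /= mulr1.
Qed.

Lemma is_derive_sinZ k u :
  is_derive u 1 (fun x => sin (k * x)) (k * cos (k * u)).
Proof.
have := is_derive1_comp (is_derive_sin (k * u)) (is_derive_scale k u).
by rewrite mulrC.
Qed.

Lemma is_derive_cosZ k u :
  is_derive u 1 (fun x => cos (k * x)) (- (k * sin (k * u))).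
Proof.
have := is_derive1_comp (is_derive_cos (k * u)) (is_derive_scale k u).
by rewrite mulNr mulrC.
Qed.

Lemma continuous_sinZ k : continuous (fun x : R => sin (k * x)).
Proof. by move=> u; exact: (is_derive_continuous (is_derive_sinZ k u)). Qed.

Lemma continuous_cosZ k : continuous (fun x : R => cos (k * x)).
Proof. by move=> u; exact: (is_derive_continuous (is_derive_cosZ k u)). Qed.

Lemma measurable_sinZ k : measurable_fun setT (fun x : R => sin (k * x)).
Proof. apply: continuous_measurable_fun; exact: continuous_sinZ. Qed.

Lemma measurable_cosZ k : measurable_fun setT (fun x : R => cos (k * x)).
Proof. apply: continuous_measurable_fun; exact: continuous_cosZ. Qed.

Lemma measurable_log_sine : measurable_fun setT log_sine.
Proof.
apply: (measurableT_comp (@measurable_ln R)).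
apply: (measurableT_comp (@normr_measurable R setT)).
by apply: measurable_funM => //; exact: measurable_sinZ.
Qed.

Lemma sin_half_gt0 u : 0 < u < 2 * pi -> 0 < sin (2^-1 * u).
Proof. by move=> /andP[u0 u1]; apply: sin_gt0_pi; apply/andP; split; lra. Qed.

Let half_sub u : 0 < u <= pi -> 0 < u < 2 * pi.
Proof.
move=> /andP[u0 u1]; rewrite u0 /= (le_lt_trans u1) //.
by have := pi_gt0 R; lra.
Qed.

Lemma mulr_ln_gtN1 (s : R) : 0 < s -> - (s * ln s) < 1.
Proof.
move=> s0; have : ln s^-1 < s^-1 by apply: ln_sublinear; rewrite invr_gt0.
rewrite lnV ?posrE // => h.
by rewrite -(mulfV (lt0r_neq0 s0)) -mulrN ltr_pM2l.
Qed.

Lemma is_derive_ln_sin_half (c : R) u : 0 < c -> 0 < u < 2 * pi ->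
  is_derive u 1 (fun x => ln (c * sin (2^-1 * x)))
    (2^-1 * cos (2^-1 * u) / sin (2^-1 * u)).
Proof.
move=> c0 /sin_half_gt0 s0.
have ds : is_derive u 1 (fun x => c * sin (2^-1 * x))
    (c * (2^-1 * cos (2^-1 * u))).
  exact: (@is_deriveZ _ _ _ _ c _ _ _ (is_derive_sinZ 2^-1 u)).
have dl := is_derive1_ln (mulr_gt0 c0 s0).
have := @is_derive1_comp _ (@ln R) (fun x => c * sin (2^-1 * x)) u _ _ dl ds.
rewrite (_ : (c * sin (2^-1 * u))^-1 * (c * (2^-1 * cos (2^-1 * u))) =
  2^-1 * cos (2^-1 * u) / sin (2^-1 * u)) //.
by field; rewrite !gt_eqF.
Qed.

(** Majorant of [- ln (sin (u / 2))] on []0, pi]]: the factor [cos (u / 2)] gives it the elementary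
    primitive [F_dom]. The sine is multiplied by 1 to fit [is_derive_ln_sin_half] at [c = 1]. *)
Let dom u := 1 - cos (2^-1 * u) * ln (1 * sin (2^-1 * u)).

Let measurable_dom : measurable_fun setT dom.
Proof.
apply: measurable_funB => //; apply: measurable_funM.
  exact: measurable_cosZ.
apply: (measurableT_comp (@measurable_ln R)).
by apply: measurable_funM => //; exact: measurable_sinZ.
Qed.

Let cos_half_ge0 u : 0 <= u <= pi -> 0 <= cos (2^-1 * u).
Proof.
move=> /andP[u0 u1]; have := pi_gt0 R => p0.
by apply: cos_ge0_pihalf; apply/andP; split; lra.
Qed.

Let ln_sin_half_le0 u : ln (1 * sin (2^-1 * u)) <= 0.
Proof. by apply: ln_le0; rewrite mul1r sin_le1. Qed.

Let dom_ge1 u : 0 <= u <= pi -> 1 <= dom u.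
Proof.
move=> /cos_half_ge0 c0; rewrite /dom lerBrDr gerDl.
exact: mulr_ge0_le0.
Qed.

Let F_dom u := u - 2 * (sin (2^-1 * u) * ln (1 * sin (2^-1 * u)) - sin (2^-1 * u)).

Let dom_integrable : mu.-integrable `[0, pi]%classic (EFin \o dom).
Proof.
apply: (@integrable_left_improper _ _ _ _ (F_dom pi)) => //; first exact: pi_gt0.
  by move=> u /andP[u0 u1]; rewrite (le_trans ler01) // dom_ge1 // u1 ltW.
move=> e /andP[e0 e1]; exists (F_dom pi - F_dom e).
  apply: (has_int_derive (ltW e1) measurable_dom).
    move=> x /andP[ex xp].
    have xl : 0 < x < 2 * pi by apply: half_sub; rewrite xp (lt_le_trans e0).
    have d := is_deriveM (is_derive_cosZ 2^-1 x) (is_derive_ln_sin_half ltr01 xl).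
    apply: continuousB; first exact: cst_continuous.
    exact: (is_derive_continuous d).
  move=> x /andP[ex xp].
  have xl : 0 < x < 2 * pi by apply: half_sub; rewrite xp (lt_le_trans e0).
  have ds := is_derive_sinZ 2^-1 x.
  have d := is_deriveM ds (is_derive_ln_sin_half ltr01 xl).
  have := is_deriveB (is_derive_id x 1) (is_deriveZ 2 (is_deriveB d ds)).
  rewrite /GRing.scale /= -/F_dom => dd.
  have s0 := sin_half_gt0 xl.
  apply: is_derive_eq; rewrite /dom /GRing.scale /=.
  by move: (ln _) => L; field; rewrite gt_eqF.
have s0 : 0 <= sin (2^-1 * e).
  by rewrite ltW // sin_half_gt0 // half_sub // e0 ltW.
(* The uniform bound [F_dom pi] amounts to [F_dom e >= 0], which holds since [s ln s <= 0]. *)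
rewrite lerBlDr lerDl /F_dom.
have := mulr_ge0_le0 s0 (ln_sin_half_le0 e).
move: (ln _) => L; nra.
Qed.

Lemma log_sine_integrable : mu.-integrable `[0, pi]%classic (EFin \o log_sine).
Proof.
have l2 : 0 <= ln 2 :> R by rewrite ln_ge0 // ler1n.
have int_d : mu.-integrable `[0, pi]%classic (EFin \o (fun u => ln 2 + dom u)).
  rewrite (_ : EFin \o _ = (fun=> (ln 2)%:E) \+ (EFin \o dom))%E //.
  apply: integrableD => //=.
  apply: (@continuous_compact_integrable _ (fun=> ln 2)); first exact: segment_compact.
  by apply: continuous_subspaceT => x; exact: cst_continuous.
apply: le_integrable int_d => //.
  apply: measurable_funTS; apply/measurable_EFinP; exact: measurable_log_sine.
move=> u /=; rewrite in_itv /= => /andP[u0 u1]; rewrite lee_fin.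
have d1 : 1 <= dom u by rewrite dom_ge1 // u0.
rewrite [X in _ <= X]ger0_norm; last by lra.
move: u0 d1; rewrite le_eqVlt => /predU1P[<-|u0] d1.
  by rewrite /log_sine mulr0 sin0 mulr0 normr0 ln0 // normr0; lra.
have s0 : 0 < sin (2^-1 * u) by rewrite sin_half_gt0 // half_sub // u0.
rewrite /log_sine (@ger0_norm _ (2 * _)) ?mulr_ge0 ?(ltW s0) // lnM ?posrE //.
have h1 := mulr_ln_gtN1 s0.
have L0 := ln_sin_half_le0 u; rewrite mul1r in L0.
have c0 : 0 <= cos (2^-1 * u) by rewrite cos_half_ge0 // u1 ltW.
have cs := cos2Dsin2 (2^-1 * u).
apply: (le_trans (ler_normD _ _)).
rewrite ger0_norm // lerD2l ler0_norm // /dom mul1r.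
move: (cos _) (sin _) (ln (sin _)) L0 h1 s0 c0 cs {d1} => c s L L0 h1 s0 c0 cs.
(* As [1 - c <= s], inserting the cosine loses at most [- s ln s < 1], which the constant 1 in [dom]
   absorbs. *)
have sc : 1 <= c + s by nra.
nra.
Qed.

Lemma has_int_mul_bounded (w f : R -> R) (a b v : R) :
  measurable_fun setT w -> (forall x, `|w x| <= 1) -> has_int a b f v ->
  exists v', has_int a b (fun x => w x * f x) v'.
Proof.
move=> mw w1 [mf fi _].
have mwf : measurable_fun setT (fun x => w x * f x) by exact: measurable_funM.
apply: integrable_has_int => //.
apply: le_integrable fi => //.
  by apply: measurable_funTS; exact/measurable_EFinP.
by move=> x _ /=; rewrite lee_fin normrM ler_piMl.
Qed.

(** Measures the zero of [sin (j u)] at 0 by the argument of the logarithm itself, for the squeeze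
    in [continuous_sin_ln0]. *)
Lemma norm_sin_nat_le j u :
  `|sin (j%:R * u)| <= j%:R * `|2 * sin (2^-1 * u)|.
Proof.
elim: j => [|j IH]; first by rewrite !mul0r sin0 normr0.
have su : sin u = 2 * sin (2^-1 * u) * cos (2^-1 * u).
  have -> : sin u = sin (2^-1 * u + 2^-1 * u) by congr sin; lra.
  by rewrite sinD; ring.
rewrite -natr1 !(mulrDl j%:R 1) !mul1r sinD (le_trans (ler_normD _ _)) // lerD //.
  by apply: (le_trans _ IH); rewrite normrM ler_piMr // cos_max.
apply: (@le_trans _ _ `|sin u|); first by rewrite normrM ler_piMl // cos_max.
by rewrite su normrM ler_piMr // cos_max.
Qed.

Lemma continuous_sin_ln0 j :
  {for (0 : R), continuous (fun u => sin (j%:R * u) * ln (2 * sin (2^-1 * u)))}.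
Proof.
rewrite /prop_for /continuous_at /= !mulr0 sin0 mul0r.
(* With [0 < y = 2 sin (u / 2) < 1] and [r = sqrt y], one has [y |ln y| = 2 r^2 |ln r| <= 2 r]. For
   [y <= 0] both [ln y] and [sqrt y] are 0, so the bound holds on both sides of 0. *)
pose h u := 2 * j%:R * Num.sqrt (2 * sin (2^-1 * u)).
have c0 : {for (0 : R), continuous (fun u => 2 * sin (2^-1 * u))}.
  by apply: continuousM; [exact: cst_continuous|exact: continuous_sinZ].
have h0 : (h u @[u --> 0] --> (0 : R))%classic.
  have : {for (0 : R), continuous h}.
    apply: continuousM; first exact: cst_continuous.
    by apply: continuous_comp => //; exact: sqrt_continuous.
  by rewrite /prop_for /continuous_at /h mulr0 sin0 mulr0 sqrtr0 mulr0.
apply: (@squeeze_cvgr _ _ _ _ (fun u => - h u) h) => //; last first.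
  by have := cvgN h0; rewrite oppr0; apply.
have l1 : \forall u \near (0 : R), 2 * sin (2^-1 * u) < 1.
  have : (2 * sin (2^-1 * u) @[u --> 0] --> (2 * sin (2^-1 * 0) : R))%classic.
    exact: c0.
  by rewrite mulr0 sin0 mulr0 => /cvgr_lt; apply; exact: ltr01.
apply: filterS l1 => u l1; rewrite -ler_norml /h.
have sj := norm_sin_nat_le j u.
move: (2 * sin _) l1 sj => y y1 sj.
have [y0|y0] := leP y 0.
  by rewrite ln0 // mulr0 normr0 !mulr_ge0 ?sqrtr_ge0.
set r := Num.sqrt y; have r0 : 0 < r by rewrite sqrtr_gt0.
have yE : y = r ^+ 2 by rewrite sqr_sqrtr // ltW.
have lr0 : ln r <= 0.
  by apply: ln_le0; rewrite -sqrtr1; apply: ler_wsqrtr; exact: ltW.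
have h1 := mulr_ln_gtN1 r0.
rewrite normrM (le_trans (ler_wpM2r _ sj)) // (gtr0_norm y0) yE lnXn // mulr2n.
rewrite ler0_norm; last by lra.
have j0 : 0 <= j%:R :> R by [].
move: (j%:R) (ln r) j0 lr0 h1 => J L J0 L0 h1.
have : 0 <= J * r * (1 + r * L) by rewrite !mulr_ge0 //; lra.
lra.
Qed.

Definition cos_primitive j u : R := if j is 0 then u else sin (j%:R * u) / j%:R.

Lemma is_derive_cos_primitive j u :
  is_derive u 1 (cos_primitive j) (cos (j%:R * u)).
Proof.
case: j => [|j]; first by rewrite mul0r cos0; exact: is_derive_id.
have d := is_deriveZ (j.+1%:R)^-1 (is_derive_sinZ j.+1%:R u).
rewrite (_ : cos_primitive j.+1 =
  (j.+1%:R)^-1 *: (fun x => sin (j.+1%:R * x))); last first.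
  by apply/funext => x; rewrite /= mulrC.
by apply: is_derive_eq; rewrite /GRing.scale /= mulrA mulVf ?mul1r // pnatr_eq0.
Qed.

(** Primitive of [t j], which for [j > 0] is [1 + 2 cos u + ... + 2 cos ((j - 1) u) + cos (j u)],
    grouped in pairs to suit induction. *)
Let T j u : R := \sum_(i < j) (cos_primitive i u + cos_primitive i.+1 u).
Let t j u : R := \sum_(i < j) (cos (i%:R * u) + cos (i.+1%:R * u)).

Let is_derive_T j u : is_derive u 1 (T j) (t j u).
Proof.
rewrite (_ : T j = \sum_(i < j) (cos_primitive i + cos_primitive i.+1)).
  apply: is_derive_sum => i.
  exact: (is_deriveD (is_derive_cos_primitive _ _) (is_derive_cos_primitive _ _)).
by apply/funext => x; rewrite /T fct_sumE.
Qed.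

(* [t j] is the Dirichlet-type kernel [cot (u/2) sin (j u)]. *)
Let sin_half_t j u :
  sin (2^-1 * u) * t j u = cos (2^-1 * u) * sin (j%:R * u).
Proof.
elim: j => [|j IH]; first by rewrite /t big_ord0 mul0r sin0 !mulr0.
rewrite /t big_ord_recr /= mulrDr -/(t j u) IH.
have [p -> ->] : exists2 p, j.+1%:R * u = p + 2^-1 * u &
    j%:R * u = p - 2^-1 * u.
  exists (j%:R * u + 2^-1 * u); last by rewrite addrK.
  by rewrite -[j.+1%:R]natr1 mulrDl mul1r; move: (j%:R * u) => ju; lra.
by move: (2^-1 * u) => q; rewrite !sinD !cosD !sinN !cosN; ring.
Qed.

Lemma has_int_cos_log_sine j :
  has_int 0 pi (fun u => cos (j.+1%:R * u) * log_sine u) (- (pi / (2 * j.+1%:R))).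
Proof.
pose f u := cos (j.+1%:R * u) * ln (2 * sin (2^-1 * u)).
(* Integration by parts leaves half of [cot (u / 2) sin (j.+1 u)], which [sin_half_t] identifies
   with half of [t j.+1]. *)
pose F u := (j.+1%:R)^-1 * (sin (j.+1%:R * u) * ln (2 * sin (2^-1 * u))
                            - 2^-1 * T j.+1 u).
have n0 : j.+1%:R != 0 :> R by rewrite pnatr_eq0.
have p0 := pi_gt0 R; have two0 : 0 < 2 :> R by [].
have mf : measurable_fun setT f.
  apply: measurable_funM; first exact: measurable_cosZ.
  apply: (measurableT_comp (@measurable_ln R)).
  by apply: measurable_funM => //; exact: measurable_sinZ.
have [_ [mcg cgi _]] : exists v', has_int 0 pi
    (fun u => cos (j.+1%:R * u) * log_sine u) v'.
  have [v hv] := integrable_has_int measurable_log_sine log_sine_integrable.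
  apply: has_int_mul_bounded hv; first exact: measurable_cosZ.
  by move=> x; exact: cos_max.
have eqf u : 0 <= u <= pi -> cos (j.+1%:R * u) * log_sine u = f u.
  move=> /andP[u0 u1]; rewrite /log_sine (@ger0_norm _ (2 * _)) // mulr_ge0 //.
  by apply: sin_ge0_pi; apply/andP; split; lra.
have sub u : 0 < u < pi -> 0 < u < 2 * pi.
  by move=> /andP[u0 u1]; apply: half_sub; rewrite u0 ltW.
have dF u : 0 < u < 2 * pi -> is_derive u 1 F (f u).
  move=> u0; have s0 := sin_half_gt0 u0.
  have d1 := is_deriveM (is_derive_sinZ j.+1%:R u)
                        (is_derive_ln_sin_half two0 u0).
  have := is_deriveZ (j.+1%:R)^-1 (is_deriveB d1 (is_deriveZ 2^-1 (is_derive_T j.+1 u))).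
  rewrite -/F => d; apply: is_derive_eq; rewrite /GRing.scale /= /f.
  have := sin_half_t j.+1 u.
  move: (t j.+1 u) (sin (j.+1%:R * u)) (ln _) (cos (j.+1%:R * u)) => tt sj L cj e.
  have -> : tt = cos (2^-1 * u) * sj / sin (2^-1 * u).
    by rewrite -e mulrAC divff ?mul1r // gt_eqF.
  move: (j.+1%:R) n0 => n n0.
  by field; rewrite n0 gt_eqF.
have F0 : F 0 = 0.
  rewrite /F mulr0 sin0 mul0r sub0r /T big1 ?mulr0 ?oppr0 ?mulr0 // => i _.
  by case: i => [[|i] ?] /=; rewrite /cos_primitive ?mulr0 ?sin0 ?mul0r ?addr0.
(* At [pi] every sine vanishes; only [cos_primitive 0 pi = pi], from the constant term of the
   kernel, remains. *)
have Fpi : F pi = - (pi / (2 * j.+1%:R)).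
  rewrite /F sin_natpi mul0r sub0r (_ : T j.+1 pi = pi).
    by move: (j.+1%:R) n0 => n n0; field.
  have cpS i : cos_primitive i.+1 pi = 0.
    by rewrite /cos_primitive sin_natpi mul0r.
  rewrite /T big_ord_recl big1 ?cpS ?addr0 // => i _.
  by rewrite lift0 !cpS addr0.
apply: (@has_int_eq_off _ [::] _ _ f) => //.
  by move=> x xp _; exact: eqf.
have -> : - (pi / (2 * j.+1%:R)) = F pi - F 0 by rewrite F0 Fpi subr0.
apply: (has_int_FTC p0 mf).
- apply: eq_integrable cgi => //= u; rewrite inE /= in_itv /= => up.
  by rewrite eqf.
- move=> x /sub xl.
  have d := is_deriveM (is_derive_cosZ j.+1%:R x) (is_derive_ln_sin_half two0 xl).
  exact: (is_derive_continuous d).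
- apply: continuous_in_subspaceT => x; rewrite inE /= in_itv /= => /andP[x0 xp].
  move: x0; rewrite le_eqVlt => /predU1P[<-|x0]; last first.
    by apply: (is_derive_continuous (dF x _)); rewrite half_sub // x0.
  suff : {for (0 : R), continuous F} by [].
  apply: continuousM; first exact: cst_continuous.
  apply: continuousB; first exact: continuous_sin_ln0.
  apply: continuousM; first exact: cst_continuous.
  exact: (is_derive_continuous (is_derive_T _ _)).
- by move=> x /sub; exact: dF.
Qed.

End LogSine.

(** * Periodicity, duplication and translation of [log_sine] *)

Section LogSineShift.
Context {R : realType}.
Notation log_sine := (@log_sine R).
Implicit Types (u phi v : R) (j : nat).

Lemma log_sineN u : log_sine (- u) = log_sine u.
Proof. by rewrite /log_sine mulrN sinN mulrN normrN. Qed.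

Lemma log_sineD2pi u : log_sine (u + 2 * pi) = log_sine u.
Proof.
rewrite /log_sine mulrDr mulrA mulVf // mul1r sinDpi mulrN normrN //.
Qed.

Lemma cos_natD2pi j u : cos (j%:R * (u + 2 * pi)) = cos (j%:R * u).
Proof.
rewrite mulrDr (_ : j%:R * (2 * pi) = (pi *+ 2) *+ j).
  by rewrite (periodicn (@cosD2pi R)).
by rewrite [2 * pi]mulr_natl [j%:R * _]mulr_natl.
Qed.

Lemma cos_nat2pi j : cos ((2 * j)%:R * pi) = 1 :> R.
Proof.
have := cos_natD2pi j 0; rewrite add0r !mulr0 cos0 => h.
by rewrite natrM -[RHS]h; congr cos; ring.
Qed.

Lemma log_sine_double u : sin u != 0 ->
  log_sine (2 * u) = log_sine u + log_sine (u + pi).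
Proof.
move=> su; rewrite /log_sine mulrA mulVf // mul1r mulrDr.
rewrite -lnM ?posrE -?normrM; last 2 first.
- rewrite normr_gt0; apply: contra_neq su => s0.
  have -> : sin u = sin (2^-1 * u + 2^-1 * u) by congr sin; lra.
  by rewrite sinD; move: s0; move: (sin _) (cos _) => s c s0; nra.
- rewrite normr_gt0 (mulrC 2^-1 pi) sinDpihalf; apply: contra_neq su => s0.
  have -> : sin u = sin (2^-1 * u + 2^-1 * u) by congr sin; lra.
  by rewrite sinD; move: s0; move: (cos _) (sin _) => c s s0; nra.
rewrite (mulrC 2^-1 pi) sinDpihalf; congr (ln `|_|).
have -> : sin u = sin (2^-1 * u + 2^-1 * u) by congr sin; lra.
by rewrite sinD; ring.
Qed.

(* Duplication trick: [2 sin u = (2 sin (u/2)) (2 cos (u/2))] makes the integral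
   equal to its own double. *)
Lemma has_int_log_sine : has_int 0 pi log_sine 0.
Proof.
have p0 := pi_gt0 R.
have [v h1] := integrable_has_int (@measurable_log_sine R) (@log_sine_integrable R).
have h2 : has_int pi (2 * pi) log_sine v.
  have := @has_int_affine R (-1) (2 * pi) _ 0 pi pi (2 * pi) log_sine v _ h1.
  rewrite normrN1 divr1 (_ : (fun x => _) = log_sine).
    apply; first by rewrite oppr_eq0 oner_eq0.
    by move=> x; apply/idP/idP => /andP[? ?]; apply/andP; split; lra.
  by apply/funext => x; rewrite log_sineD2pi mulN1r log_sineN.
have h3 := has_int_cat (ltW p0) (_ : pi <= 2 * pi) h1 h2.
have {}h3 : has_int 0 (2 * pi) log_sine (v + v) by apply: h3; lra.
have h4 : has_int 0 pi (fun x => log_sine (2 * x + 0)) ((v + v) / `|2|).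
  apply: has_int_affine h3 => // x.
  by apply/idP/idP => /andP[? ?]; apply/andP; split; lra.
have h5 : has_int 0 pi (fun x => log_sine (1 * x + pi)) (v / `|1|).
  apply: has_int_affine h2; first exact: oner_neq0.
  by move=> x; apply/idP/idP => /andP[? ?]; apply/andP; split; lra.
rewrite normr1 divr1 in h5.
have h6 : has_int 0 pi (fun x => log_sine (2 * x + 0)) (v + v).
  have m4 : measurable_fun setT (fun x : R => log_sine (2 * x + 0)) by case: h4.
  (* Duplication fails at 0 and [pi]: one side is [ln 0 = 0], the other [ln 2]. *)
  apply: (has_int_eq_off (N := [:: 0; pi]) m4 _ (has_intD h1 h5)).
  move=> x /andP[x0 xp]; rewrite !inE negb_or => /andP[n0 np].
  rewrite addr0 mul1r log_sine_double // gt_eqF // sin_gt0_pi //.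
  by rewrite lt_neqAle eq_sym n0 x0 lt_neqAle np xp.
have e := has_int_unique h4 h6.
have v0 : v = 0 by move: e; rewrite ger0_norm //; lra.
by move: h1; rewrite v0.
Qed.

(* Translate by [phi] over a full period and use that [log_sine] is even. *)
Lemma has_int_cos_log_sine_shift j K phi : 0 <= phi <= pi ->
  has_int 0 pi (fun u => cos (j%:R * u) * log_sine u) K ->
  has_int 0 pi
    (fun t => cos (j%:R * t) * (log_sine (t + phi) + log_sine (t - phi)))
    (2 * cos (j%:R * phi) * K).
Proof.
move=> /andP[phi0 phip] hC.
have p0 := pi_gt0 R.
have nz1 : -1 != 0 :> R by rewrite oppr_eq0 oner_eq0.
have onz : 1 != 0 :> R by exact: oner_neq0.
have hC' : has_int (- pi) 0 (fun u => cos (j%:R * u) * log_sine u) K.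
  have := @has_int_affine R (-1) 0 nz1 0 pi (- pi) 0 _ K _ hC.
  rewrite normrN1 divr1 (_ : (fun x => _) =
    (fun u => cos (j%:R * u) * log_sine u)); last first.
    by apply/funext => x; rewrite addr0 mulN1r mulrN cosN log_sineN.
  by apply=> x; apply/idP/idP => /andP[? ?]; apply/andP; split; lra.
have hC2 := has_int_cat (_ : - pi <= 0) (ltW p0) hC' hC.
have {}hC2 : has_int (- pi) pi (fun u => cos (j%:R * u) * log_sine u) (K + K).
  by apply: hC2; lra.
(* Expanding [cos (j (u + phi))] also yields a sine term; odd against the even [log_sine], it
   integrates to 0 over [[- pi, pi]]. *)
have [vS hS] : exists v, has_int 0 pi (fun u => sin (j%:R * u) * log_sine u) v.
  apply: has_int_mul_bounded has_int_log_sine; first exact: measurable_sinZ.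
  by move=> x; exact: sin_max.
have hS' : has_int (- pi) 0 (fun u => sin (j%:R * u) * log_sine u) (-1 * vS).
  have := @has_int_affine R (-1) 0 nz1 0 pi (- pi) 0 _ vS _ hS.
  rewrite normrN1 divr1 => /(_ _)/(has_intZ (-1)).
  rewrite (_ : (fun x => _) = (fun u => sin (j%:R * u) * log_sine u)); last first.
    by apply/funext => x; rewrite addr0 (mulN1r x) mulrN sinN log_sineN; ring.
  by apply=> x; apply/idP/idP => /andP[? ?]; apply/andP; split; lra.
have hS2 := has_int_cat (_ : - pi <= 0) (ltW p0) hS' hS.
have {}hS2 : has_int (- pi) pi (fun u => sin (j%:R * u) * log_sine u) 0.
  rewrite [X in has_int _ _ _ X](_ : 0 = -1 * vS + vS); first by apply: hS2; lra.
  by rewrite mulN1r addNr.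
pose W u := cos (j%:R * (u + phi)) * log_sine u.
have hW : has_int (- pi) pi W (2 * cos (j%:R * phi) * K).
  have := has_intD (has_intZ (cos (j%:R * phi)) hC2)
                   (has_intZ (- sin (j%:R * phi)) hS2).
  rewrite (_ : (fun x => _) = W); last first.
    by apply/funext => x; rewrite /W mulrDr cosD; ring.
  by rewrite (_ : _ + _ = 2 * cos (j%:R * phi) * K) //; ring.
(* The piece over [[pi - phi, pi]] is moved back by [2 pi], so that [W] is integrated over
   [[- pi - phi, pi - phi]]. Cutting at [- phi], the right half becomes the [t - phi] term by
   [u = t - phi], the left half the [t + phi] term by [u = - t - phi]. *)
have [w1 h1] : exists v, has_int (- pi) (pi - phi) W v.
  by apply: has_intS hW; lra.
have [w2 h2] : exists v, has_int (pi - phi) pi W v.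
  by apply: has_intS hW; lra.
have e12 : w1 + w2 = 2 * cos (j%:R * phi) * K.
  by apply: has_int_unique hW; apply: has_int_cat h1 h2; lra.
have h2' : has_int (- pi - phi) (- pi) W w2.
  have := @has_int_affine R 1 (2 * pi) onz _ _ (- pi - phi) (- pi) _ _ _ h2.
  rewrite normr1 divr1 (_ : (fun x => _) = W); last first.
    apply/funext => x; rewrite /W mul1r log_sineD2pi addrAC.
    by rewrite cos_natD2pi.
  by apply=> x; apply/idP/idP => /andP[? ?]; apply/andP; split; lra.
have h3 : has_int (- pi - phi) (pi - phi) W (w2 + w1).
  by apply: has_int_cat h2' h1; lra.
have [w4 h4] : exists v, has_int (- phi) (pi - phi) W v.
  by apply: has_intS h3; lra.
have [w5 h5] : exists v, has_int (- pi - phi) (- phi) W v.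
  by apply: has_intS h3; lra.
have e45 : w5 + w4 = w2 + w1.
  by apply: has_int_unique h3; apply: has_int_cat h5 h4; lra.
have h6 : has_int 0 pi (fun t => cos (j%:R * t) * log_sine (t - phi)) w4.
  have := @has_int_affine R 1 (- phi) onz _ _ 0 pi _ _ _ h4.
  rewrite normr1 divr1 (_ : (fun x => _) =
    (fun t => cos (j%:R * t) * log_sine (t - phi))); last first.
    by apply/funext => x; rewrite /W mul1r subrK.
  by apply=> x; apply/idP/idP => /andP[? ?]; apply/andP; split; lra.
have h7 : has_int 0 pi (fun t => cos (j%:R * t) * log_sine (t + phi)) w5.
  have := @has_int_affine R (-1) (- phi) nz1 _ _ 0 pi _ _ _ h5.
  rewrite normrN1 divr1 (_ : (fun x => _) =
    (fun t => cos (j%:R * t) * log_sine (t + phi))); last first.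
    apply/funext => x; rewrite /W mulN1r subrK mulrN cosN -opprD log_sineN //.
  by apply=> x; apply/idP/idP => /andP[? ?]; apply/andP; split; lra.
have := has_intD h7 h6.
rewrite e45 addrC e12 (_ : (fun x => _) =
  (fun t => cos (j%:R * t) * (log_sine (t + phi) + log_sine (t - phi)))) //.
by apply/funext => x; rewrite mulrDr.
Qed.

End LogSineShift.

(** * The integrals I_m *)

Section GegenbauerIntegral.
Context {R : realType}.

Lemma has_int_cos j : has_int 0 pi (fun t : R => cos (j%:R * t))
  (if j is 0 then pi else 0).
Proof.
have -> : (if j is 0 then pi else 0 : R) = cos_primitive j pi - cos_primitive j 0.
  case: j => [|j] /=; first by rewrite subr0.
  by rewrite sin_natpi mulr0 sin0 !mul0r subr0.
apply: (has_int_derive (pi_ge0 R) (measurable_cosZ _)) => x _.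
  exact: continuous_cosZ.
exact: is_derive_cos_primitive.
Qed.

Lemma ln_sqr_cosB (t phi : R) : cos t != cos phi ->
  ln ((2 * (cos t - cos phi)) ^+ 2) =
  2 * (log_sine (t + phi) + log_sine (t - phi)).
Proof.
move=> ne.
have e : 2 * (cos t - cos phi) =
    - ((2 * sin (2^-1 * (t + phi))) * (2 * sin (2^-1 * (t - phi)))).
  have -> : cos t = cos (2^-1 * (t + phi) + 2^-1 * (t - phi)) by congr cos; lra.
  have -> : cos phi = cos (2^-1 * (t + phi) - 2^-1 * (t - phi)) by congr cos; lra.
  by rewrite cosD cosB; ring.
have nz : 2 * (cos t - cos phi) != 0 by rewrite mulf_neq0 // subr_eq0.
move: nz; rewrite e oppr_eq0 mulf_eq0 negb_or => /andP[n1 n2].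
have p0 : 0 < `|2 * sin (2^-1 * (t + phi)) * (2 * sin (2^-1 * (t - phi)))|.
  by rewrite normr_gt0 mulf_neq0.
rewrite sqrrN -real_normK ?num_real // (lnXn 2 p0) normrM.
by rewrite lnM ?posrE ?normr_gt0 // [RHS]mulr_natl.
Qed.

Lemma measurable_Iintegrand lam n m :
  measurable_fun [set: R] (@Iintegrand R lam n m).
Proof.
apply: measurable_funM; first exact: measurable_cosZ.
apply: (measurableT_comp (@measurable_ln R)).
rewrite (_ : (fun t => _) = horner (gegenbauer_poly lam n ^+ 2) \o cos).
  apply: continuous_measurable_fun => t; apply: continuous_comp.
    exact: continuous_cos.
  exact: continuous_horner.
by apply/funext => t; rewrite /= horner_exp horner_gegenbauer_poly.
Qed.

(** [K] is left abstract so that [m = 0] and [m > 0] share one computation. In [4 K], one factor 2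
    comes from the square under the logarithm, the other from the two translates. *)
Lemma has_int_Iintegrand lam n m (s : seq R) K : size s = n ->
  all (mem `]-1, 1[) s ->
  (forall x, gegenbauer lam.+1 n x =
    2 ^+ n * (pochhammer lam.+1%:R n / n`!%:R) * \prod_(y <- s) (x - y)) ->
  has_int 0 pi (fun u => cos ((2 * m)%:R * u) * log_sine u) K ->
  has_int 0 pi (Iintegrand lam.+1 n m)
    (2 * ln (pochhammer lam.+1%:R n / n`!%:R) * (if m is 0 then pi else 0)
     + \sum_(y <- s) 4 * K * cos ((2 * m)%:R * acos y)).
Proof.
move=> ss s1 sE hK.
have b0 := @pochhammer_fact_gt0 R lam n.
move: (pochhammer _ _ / _) b0 sE => b b0 sE.
have acos_itv y : y \in s -> 0 <= acos y <= pi.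
  move=> /(allP s1) /andP[y1 y2]; have yy : -1 <= y <= 1 by rewrite !ltW.
  by rewrite acos_ge0 // acos_lepi.
have cosac y : y \in s -> cos (acos y) = y.
  move=> /(allP s1) /andP[y1 y2]; rewrite acosK // in_itv /=.
  by rewrite !ltW.
pose g t := 2 * ln b * cos ((2 * m)%:R * t) + \sum_(y <- s) 2 *
  (cos ((2 * m)%:R * t) * (log_sine (t + acos y) + log_sine (t - acos y))).
apply: (has_int_eq_off (N := [seq acos y | y <- s]) (f := g)).
- exact: measurable_Iintegrand.
- move=> t /andP[t0 tp] tN; rewrite /Iintegrand /g sE.
  (* Each of the [n] linear factors takes one 2 from [2^n], because [2 (cos t - cos phi)]
     contributes no constant; only [b] is left for [I_0]. *)
  have -> : (2 ^+ n * b * \prod_(y <- s) (cos t - y)) ^+ 2 =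
      b ^+ 2 * \prod_(y <- s) (2 * (cos t - cos (acos y))) ^+ 2.
    rewrite prodrXl -exprMn; congr (_ ^+ 2).
    rewrite mulrAC mulrC; congr (_ * _).
    rewrite big_split /= big_const_seq count_predT ss iter_mulr mulr1.
    by congr (_ * _); apply: eq_big_seq => y ys; rewrite cosac.
  have ne y : y \in s -> cos t != cos (acos y).
    move=> ys; apply: contra tN => /eqP /cos_inj ->; first exact: map_f.
      by rewrite in_itv /= t0.
    by rewrite in_itv /= acos_itv.
  have pos y : y \in s -> 0 < (2 * (cos t - cos (acos y))) ^+ 2.
    by move=> /ne h; rewrite exprn_even_gt0 //= mulf_neq0 // subr_eq0.
  rewrite lnM ?posrE ?exprn_gt0 //; last first.
    by rewrite big_seq; apply: prodr_gt0 => y /pos.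
  rewrite lnXn // ln_prod // mulrDr -[ln b *+ 2]mulr_natl; congr (_ + _).
    by rewrite mulrC.
  rewrite mulr_sumr; apply: eq_big_seq => y ys.
  by rewrite ln_sqr_cosB ?ne // mulrCA.
apply: has_intD.
  have := has_int_cos (2 * m); rewrite (_ : (if _ is 0 then _ else _) =
    (if m is 0 then pi else 0 : R)); last by case: m {hK g}.
  exact: has_intZ.
apply: has_int_sum => y ys.
have -> : 4 * K * cos ((2 * m)%:R * acos y) =
  2 * (2 * cos ((2 * m)%:R * acos y) * K) by ring.
by apply: has_intZ; apply: has_int_cos_log_sine_shift; rewrite // acos_itv.
Qed.

End GegenbauerIntegral.

Unset Implicit Arguments.

Theorem theorem1 (R : realType) (lam n : nat) (hlam : (0 < lam)%N) :
  (forall m : nat,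
     (@lebesgue_measure R).-integrable `[0, pi]%classic
        (fun t => (Iintegrand lam n m t)%:E)) /\
  Imn lam n 0 = (2 * pi * ln (pochhammer (lam%:R : R) n / n`!%:R))%:E /\
  (forall m : nat, (0 < m)%N ->
     Imn lam n m =
       ((2 * lam%:R - 1) * pi / m%:R
        + pi / (2 * m)`!%:R
          * derive1n (2 * m) (fun z : R => ln `|pz lam n z|) 0)%:E).
Proof.
case: lam hlam => // lam _.
have [s [ss s1 sE]] := @gegenbauer_factor R lam n.
have h0 : has_int 0 pi (fun u : R => cos ((2 * 0)%:R * u) * log_sine u) 0.
  rewrite (_ : (fun u => _) = log_sine); first exact: has_int_log_sine.
  by apply/funext => u; rewrite mul0r cos0 mul1r.
(* Here [K = - pi / (4 m)], so [4 K = - pi / m]. *)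
have hS m : (0 < m)%N -> has_int 0 pi
    (fun u : R => cos ((2 * m)%:R * u) * log_sine u) (- (pi / (2 * (2 * m)%:R))).
  case: m => // m _; rewrite (_ : 2 * m.+1 = (2 * m).+2)%N; last by lia.
  exact: has_int_cos_log_sine.
split; [|split].
- case=> [|m]; first by have [] := has_int_Iintegrand ss s1 sE h0.
  by have [] := has_int_Iintegrand ss s1 sE (hS m.+1 isT).
- have [_ _] := has_int_Iintegrand ss s1 sE h0.
  rewrite /Imn /Iset => ->; congr EFin.
  rewrite big1 => [|y _]; last by rewrite mulr0 mul0r.
  by rewrite addr0; ring.
move=> m m0; have [_ _] := has_int_Iintegrand ss s1 sE (hS m m0).
rewrite /Imn /Iset => ->; congr EFin.
have tE := taylor_coef_ln_pz (2 * m).-1 ss s1 sE.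
(* Since [cos (2 m pi) = 1], the zeros 1 and -1 contribute [- (2 lam + 1) / m], cancelled by the
   explicit term of the statement at [lam.+1]. *)
rewrite prednK ?muln_gt0 // cos_nat2pi in tE.
rewrite [pi / _ * _](_ : _ = pi *
  taylor_coef (2 * m) (fun z => ln `|pz lam.+1 n z|)); last by rewrite mulrAC -mulrA.
rewrite tE.
have mn0 : m%:R != 0 :> R by rewrite pnatr_eq0 -lt0n.
rewrite -mulr_sumr; case: m m0 mn0 {hS tE} => // m _ mn0.
move: (\sum_(y <- s) _) => S.
rewrite natrM -[(2 * lam).+1%:R]natr1 natrM -[lam.+1%:R]natr1.
by move: (m.+1%:R) mn0 => M M0; field.
Qed.
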